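(* Let $f$ be a function on $\mathbb R$ whose Fourier transform vanishes for negative arguments and which is normalised ($\int_0^\infty\frac{dp}{2p}|\tilde f(p)|^2=1$), such that $f$ and $f'$ exist and are integrable, and suppose there are constants $C>0$, $L>1$, $\alpha>1/2$, $\varepsilon>0$ with \[ |f(y)|\le\frac{C}{(-y)^{1+\varepsilon}}\ (y\le -L),\qquad |f(y)|\le \frac{C}{y^{1+\alpha}}\ (y\ge L).\] Then $\bar N[f]<\infty$, and if moreover $\varepsilon>1/2$, then $\bar N^{Th}_{2\pi}[f]<\infty$.
   Context: Fourier transforms are $\tilde g(p)=(2\pi)^{-1/2}\int g(y)e^{-ipy}dy$. With $x(y)=-\log(1+e^{-y})$, $\widetilde{\check f}(-k)=(2\pi)^{-1/2}\int_{\mathbb R} f(y)e^{ikx(y)}dy$ for $k\ge0$. Mean number of created particles: $\bar N[f]=\int_0^\infty\frac{dk}{2k}|\widetilde{\check f}(-k)|^2$. Thermal average: $\bar N^{Th}_\beta[f]=\int_0^\infty\frac{dp}{2p}\frac{|\tilde f(p)|^2}{e^{\beta p}-1}$. *)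

(* Defs.v *)
(* A complex-valued function f : R -> C is
   represented by its real and imaginary parts fr, fi : R -> R
   (MathComp-Analysis has no complex-valued integration). *)
From HB Require Import structures.
From mathcomp Require Import all_boot all_order all_algebra.
From mathcomp Require Import all_classical all_reals all_analysis.
Set Implicit Arguments. Unset Strict Implicit. Unset Printing Implicit Defensive.
Import Order.TTheory GRing.Theory Num.Theory.
Import numFieldNormedType.Exports.
Local Open Scope classical_set_scope.
Local Open Scope ring_scope.

Section Defs.
Variable R : realType.
Notation mu := (@lebesgue_measure R).

Definition fnorm : R := (Num.sqrt (2 * pi))^-1.

(* f = fr + i fi is integrable on R (|f| integrable <-> both parts integrable) *)
Definition cintegrable (fr fi : R -> R) : Prop :=
  mu.-integrable setT (EFin \o fr) /\ mu.-integrable setT (EFin \o fi).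

Definition cabs (fr fi : R -> R) (y : R) : R := Num.sqrt (fr y ^+ 2 + fi y ^+ 2).

(* Fourier transform  f~(p) = (2pi)^(-1/2) \int f(y) e^{-ipy} dy,
   e^{-ipy} = cos(py) - i sin(py) *)
Definition FT_re (fr fi : R -> R) (p : R) : R :=
  fnorm * \int[mu]_(y in setT) (fr y * cos (p * y) + fi y * sin (p * y)).
Definition FT_im (fr fi : R -> R) (p : R) : R :=
  fnorm * \int[mu]_(y in setT) (fi y * cos (p * y) - fr y * sin (p * y)).

Definition xmap (y : R) : R := - ln (1 + expR (- y)).

(* (f check)~(-k) = (2pi)^(-1/2) \int f(y) e^{i k x(y)} dy,
   e^{ikx} = cos(kx) + i sin(kx) *)
Definition FTc_re (fr fi : R -> R) (k : R) : R :=
  fnorm * \int[mu]_(y in setT) (fr y * cos (k * xmap y) - fi y * sin (k * xmap y)).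
Definition FTc_im (fr fi : R -> R) (k : R) : R :=
  fnorm * \int[mu]_(y in setT) (fr y * sin (k * xmap y) + fi y * cos (k * xmap y)).

Definition fnorm2 (fr fi : R -> R) : \bar R :=
  (\int[mu]_(p in `]0%R, +oo[%classic) ((FT_re fr fi p ^+ 2 + FT_im fr fi p ^+ 2) / (2 * p))%:E)%E.

Definition Nbar (fr fi : R -> R) : \bar R :=
  (\int[mu]_(k in `]0%R, +oo[%classic) ((FTc_re fr fi k ^+ 2 + FTc_im fr fi k ^+ 2) / (2 * k))%:E)%E.

Definition NTh (beta : R) (fr fi : R -> R) : \bar R :=
  (\int[mu]_(p in `]0%R, +oo[%classic)
     ((FT_re fr fi p ^+ 2 + FT_im fr fi p ^+ 2) / (2 * p) / (expR (beta * p) - 1))%:E)%E.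

End Defs.

(* Main.v *)
(* Write F(k) for the transform of the pulled-back function and split the
   k-integral at 1.  The hypothesis on negative arguments gives \int f = 0 (let
   p -> 0-), and the moment \int |f| |x|^d is finite for small d > 0, so
   F(k) = O(k^d) and the integral over ]0, 1[ converges.  For large k,
     \int_[1, M] |F(k)|^2 dk / k
   is a double integral of f(y) f(z) against \int_[1, M] cos(k (x(y) - x(z))) dk / k,
   which is at most 2 + ln+ (1 / |x(y) - x(z)|) uniformly in M.  As
   x'(y) = 1 / (1 + e^y), that logarithm is at most min(y, z)^+ up to a constant and
   an integrable singularity on the diagonal, and min(y, z)^+ <= sqrt(y^+) sqrt(z^+)
   decouples the double integral: \int |f(y)| sqrt(y^+) dy is finite because
   alpha > 1/2.
   For the thermal average one may take d > 1/2 when eps > 1/2, and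
   k^(2d) / (k (e^(2 pi k) - 1)) is then integrable at 0. *)
Require Import Defs.
From HB Require Import structures.
From mathcomp Require Import all_boot all_order all_algebra.
From mathcomp Require Import all_classical all_reals all_analysis.
From mathcomp Require Import measurable_realfun ring lra.
Import Order.TTheory GRing.Theory Num.Theory.
Import numFieldNormedType.Exports.
Local Open Scope classical_set_scope.
Local Open Scope ring_scope.
Set Implicit Arguments.
Unset Strict Implicit.
Unset Printing Implicit Defensive.

(** The hypotheses bound only |f|, so its real and imaginary parts are estimated separately: |F|^2
    is at most twice the sum of their contributions. The parts interact only where the vanishing
    transform yields \int f = 0. The obstacle at large k is that x compresses the right half-line:
    x'(y) behaves like e^(-y), so points far to the right have exponentially close images and the
    logarithm grows linearly there. Bounding min(y, z)^+ by one of y^+ and z^+ would ask for a first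
    moment of f, that is alpha > 1; the geometric mean asks for half a moment in each variable,
    which is alpha > 1/2. Near the diagonal the boundedness of f is used instead of its decay. At
    small k a fractional d is forced, since f may have no first moment. For the created particles d
    is limited by eps alone: |x(y)| grows linearly at -oo but is at most 1 for y >= 0. In the
    thermal case the phase is y itself, so d must stay below both eps and alpha, and d > 1/2 uses
    alpha > 1/2 a second time. *)

Section exhaustion.
Variable R : realType.
Notation mu := (@lebesgue_measure R).

Lemma ge0_integral_le_bigcup (F : (set R)^nat) (f : R -> R) (B : \bar R) :
  nondecreasing_seq F -> (forall i, measurable (F i)) ->
  (forall i, measurable_fun (F i) f) -> (forall i x, F i x -> 0 <= f x) ->
  (forall i, \int[mu]_(x in F i) (f x)%:E <= B)%E ->
  (\int[mu]_(x in \bigcup_i F i) (f x)%:E <= B)%E.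
Proof.
move=> ndF mF mf f0 FB.
have mf' i : measurable_fun (F i) (EFin \o f) by exact/measurable_EFinP.
have f0' i x : F i x -> (0 <= (EFin \o f) x)%E by move=> /f0; rewrite lee_fin.
have cv := @ge0_nondecreasing_set_cvg_integral _ (measurableTypeR R) R F
  (EFin \o f) mu ndF mF mf' f0'.
rewrite -(cvg_lim _ cv)//; apply: lime_le; first by apply/cvg_ex; eexists; exact: cv.
by apply: nearW => i; exact: FB.
Qed.

(** Boundedness of the primitive replaces limits at the endpoints, where f may blow up: on inner
    compact intervals the integral is a difference of two values of F, hence at most B + B. *)
Lemma ge0_integral_oo_le (f F : R -> R) (a b B : R) : a < b ->
  (forall x, a < x < b -> 0 <= f x) ->
  (forall x, a < x < b -> {for x, continuous f}) ->
  (forall x, a < x < b -> is_derive x 1 F (f x)) ->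
  (forall x, a < x < b -> `|F x| <= B) ->
  (\int[mu]_(x in `]a, b[) (f x)%:E <= (B + B)%:E)%E.
Proof.
move=> ab f0 cf dF FB.
(* The denominator starts at 3 so that 2 * d n < b - a already for n = 0 and every compact interval
   is nondegenerate. *)
pose d (n : nat) := (b - a) / n.+3%:R.
have d0 n : 0 < d n by rewrite divr_gt0 ?subr_gt0.
have dlt n : d n + d n < b - a.
  rewrite /d -mulrDr -mulr2n -[ltRHS]mulr1 ltr_pM2l ?subr_gt0//.
  by rewrite mulr2n -mulr2n -[X in X *+ 2]mul1r -mulrnAl ltr_pdivrMr// mul1r ltr_nat.
have inside n x : a + d n <= x <= b - d n -> a < x < b.
  move=> /andP[h1 h2]; have := d0 n => ?; lra.
have -> : `]a, b[%classic = \bigcup_n `[a + d n, b - d n]%classic.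
  apply/seteqP; split => x /=; last first.
    by case=> n _ /=; rewrite !in_itv/= => /inside.
  rewrite in_itv/= => /andP[ax xb].
  pose m := Num.min (x - a) (b - x).
  have m0 : 0 < m by rewrite lt_min !subr_gt0 ax xb.
  exists (Num.truncn ((b - a) / m)) => //=; rewrite in_itv/=.
  have : d (Num.truncn ((b - a) / m)) <= m.
    rewrite /d ler_pdivrMr// mulrC -ler_pdivrMr//.
    apply: ltW; apply: (lt_le_trans (truncnS_gt _)); rewrite ler_nat.
    by rewrite ltnS -addn2 leq_addr.
  rewrite le_min => /andP[h1 h2]; lra.
have cw n : {within `[a + d n, b - d n], continuous f}.
  apply: continuous_in_subspaceT => x; rewrite inE/= in_itv/= => /inside.
  exact: cf.
apply: ge0_integral_le_bigcup => //.
- apply/nondecreasing_seqP => n; rewrite subsetEset => x /=; rewrite !in_itv/=.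
  have : d n.+1 <= d n.
    by rewrite /d ler_pM2l ?subr_gt0// lef_pV2 ?posrE// ler_nat.
  lra.
- by move=> n; apply: subspace_continuous_measurable_fun.
- by move=> n x /=; rewrite in_itv/= => /inside/f0.
- move=> n; have dn := d0 n; have dl := dlt n.
  have lt : a + d n < b - d n by lra.
  have cF x : a < x < b -> {for x, continuous F}.
    move=> /dF [D _]; apply: differentiable_continuous.
    exact/derivable1_diffP.
  rewrite (@continuous_FTC2 _ f F)//.
  + rewrite -EFinB lee_fin.
    have h1 : `|F (b - d n)| <= B by apply: FB; lra.
    have h2 : `|F (a + d n)| <= B by apply: FB; lra.
    by rewrite (le_trans (ler_norm _))// (le_trans (ler_normB _ _))// lerD.
  + split.
    * move=> x; rewrite in_itv/= => hx.
      have /dF[] // : a < x < b by lra.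
    * by apply: cvg_at_right_filter; apply: cF; lra.
    * by apply: cvg_at_left_filter; apply: cF; lra.
  + move=> x; rewrite in_itv/= => hx.
    rewrite derive1E; apply: derive_val.
    by apply: dF; lra.
Qed.

End exhaustion.

(** * Integrals of powers *)

Section power_integrals.
Variable R : realType.
Notation mu := (@lebesgue_measure R).

Lemma continuous_at_powR (r x : R) : 0 < x -> {for x, continuous (fun y : R => y `^ r)}.
Proof.
move=> x0; apply: differentiable_continuous; apply/derivable1_diffP.
by have [] := is_derive1_powR r x0.
Qed.

Lemma continuous_powR_comp (u : R -> R) (r x : R) : 0 < u x ->
  {for x, continuous u} -> {for x, continuous (fun y : R => u y `^ r)}.
Proof.
move=> u0 cu; have cr := @continuous_at_powR r _ u0.
exact: (continuous_comp cu cr).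
Qed.

Lemma is_derive_powR_comp (u : R -> R) (a x du : R) :
  is_derive x 1 u du -> 0 < u x ->
  is_derive x 1 (fun y : R => u y `^ a) (a * u x `^ (a - 1) * du).
Proof.
move=> Du u0; have Dr := is_derive1_powR a u0.
by apply: is_derive_eq (is_derive1_comp Dr Du) _.
Qed.

Lemma is_derive_mull (k : R) (f : R -> R) (x df : R) :
  is_derive x 1 f df -> is_derive x 1 (fun y : R => k * f y) (k * df).
Proof. exact: is_deriveZ. Qed.

Lemma ge0_integral_oy_le (f F : R -> R) (a B : R) :
  (forall x, a < x -> 0 <= f x) ->
  (forall x, a < x -> {for x, continuous f}) ->
  (forall x, a < x -> is_derive x 1 F (f x)) ->
  (forall x, a < x -> `|F x| <= B) ->
  (\int[mu]_(x in `]a, +oo[) (f x)%:E <= (B + B)%:E)%E.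
Proof.
move=> f0 cf dF FB.
have -> : `]a, +oo[%classic = \bigcup_n `]a, a + n.+1%:R[%classic.
  apply/seteqP; split => x /=; rewrite in_itv/= ?andbT; last first.
    by case=> n _ /=; rewrite in_itv/= => /andP[].
  move=> ax; exists (Num.truncn (x - a)) => //=; rewrite in_itv/= ax/=.
  by rewrite -ltrBlDl truncnS_gt.
apply: ge0_integral_le_bigcup => //.
- apply/nondecreasing_seqP => n; rewrite subsetEset => x /=; rewrite !in_itv/=.
  by move=> /andP[->/=] /lt_trans; apply; rewrite ltrD2l ltr_nat.
- move=> n; apply: open_continuous_measurable_fun => // x.
  by rewrite inE/= in_itv/= => /andP[/cf].
- by move=> n x /=; rewrite in_itv/= => /andP[/f0].
- move=> n; apply: (@ge0_integral_oo_le _ _ F).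
  + by rewrite ltrDl.
  + by move=> x /andP[/f0].
  + by move=> x /andP[/cf].
  + by move=> x /andP[/dF].
  + by move=> x /andP[/FB].
Qed.

Lemma integral_powR_right (c a : R) : 0 < a ->
  (\int[mu]_(x in `]c, (c + 1)%R[) ((x - c) `^ (a - 1))%:E <= (a^-1 + a^-1)%:E)%E.
Proof.
move=> a0; apply: (@ge0_integral_oo_le _ _ (fun x : R => a^-1 * (x - c) `^ a)).
- lra.
- by move=> x _; exact: powR_ge0.
- move=> x /andP[cx _]; apply: continuous_powR_comp; first by rewrite subr_gt0.
  by apply: continuousB; [exact: cvg_id|exact: cvg_cst].
- move=> x /andP[cx _]; have xc : 0 < x - c by rewrite subr_gt0.
  have Du : is_derive x 1 (fun y : R => y - c) 1.
    apply: is_derive_eq (is_deriveB (is_derive_id x 1) (is_derive_cst c x 1)) _.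
    by rewrite subr0.
  apply: is_derive_eq (is_derive_mull _ (is_derive_powR_comp a Du xc)) _.
  by rewrite /= ?scaler1 ; field; rewrite gt_eqF.
- move=> x /andP[cx xc]; rewrite ger0_norm ?mulr_ge0 ?powR_ge0
    ?invr_ge0 ?(ltW a0)//.
  rewrite ler_piMr ?invr_ge0 ?(ltW a0)// //.
  apply: (@le_trans _ _ (1 `^ a)); last by rewrite powR1.
  by rewrite ge0_ler_powR ?nnegrE; lra.
Qed.

Lemma integral_powR_left (c a : R) : 0 < a ->
  (\int[mu]_(x in `](c - 1)%R, c[) ((c - x) `^ (a - 1))%:E <= (a^-1 + a^-1)%:E)%E.
Proof.
move=> a0; apply: (@ge0_integral_oo_le _ _ (fun x : R => - a^-1 * (c - x) `^ a)).
- lra.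
- by move=> x _; exact: powR_ge0.
- move=> x /andP[_ cx]; apply: continuous_powR_comp; first by rewrite subr_gt0.
  by apply: continuousB; [exact: cvg_cst|exact: cvg_id].
- move=> x /andP[_ cx]; have xc : 0 < c - x by rewrite subr_gt0.
  have Du : is_derive x 1 (fun y : R => c - y) (-1).
    apply: is_derive_eq (is_deriveB (is_derive_cst c x 1) (is_derive_id x 1)) _.
    by rewrite sub0r.
  apply: is_derive_eq (is_derive_mull _ (is_derive_powR_comp a Du xc)) _.
  by rewrite /= ; field; rewrite gt_eqF.
- move=> x /andP[xc cx]; rewrite mulNr normrN ger0_norm ?mulr_ge0 ?powR_ge0
    ?invr_ge0 ?(ltW a0)//.
  rewrite ler_piMr ?invr_ge0 ?(ltW a0)// //.
  apply: (@le_trans _ _ (1 `^ a)); last by rewrite powR1.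
  by rewrite ge0_ler_powR ?nnegrE; lra.
Qed.

Lemma continuous_decay (b : R) : continuous (fun y : R => (1 + `|y|) `^ (- 1 - b)).
Proof.
move=> x; apply: (@continuous_powR_comp (fun y : R => 1 + `|y|)); first by rewrite ltr_pwDl.
  by apply: continuousD; [exact: cvg_cst|exact: norm_continuous].
Qed.

Lemma integrable_decay (b : R) : 0 < b ->
  mu.-integrable setT (EFin \o (fun y : R => (1 + `|y|) `^ (- 1 - b))).
Proof.
move=> b0; apply/integrableP; split.
  by apply/measurable_EFinP; apply: continuous_measurable_fun; exact: continuous_decay.
under eq_integral do rewrite /= ger0_norm ?powR_ge0//.
rewrite ge0_symfun_integralT; last 3 first.
- by move=> x; exact: powR_ge0.
- exact: continuous_decay.
- by move=> x /=; rewrite normrN.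
rewrite (_ : [set x | 0 <= x] = `[0, +oo[%classic); last first.
  by apply/seteqP; split => x /=; rewrite in_itv/= andbT.
under eq_integral => x.
  rewrite inE/= in_itv/= andbT => x0.
  rewrite ger0_norm//.
  over.
rewrite -integral_itv_obnd_cbnd; last first.
  apply/measurable_EFinP.
  apply: open_continuous_measurable_fun => // x; rewrite inE/= in_itv/= andbT => x0.
  apply: continuous_powR_comp; first by rewrite addr_gt0.
  by apply: continuousD; [exact: cvg_cst|exact: cvg_id].
apply: (@le_lt_trans _ _ (2%:E * (b^-1 + b^-1)%:E)%E); last by rewrite -EFinM ltry.
rewrite lee_pmul2l ?lte_fin//.
apply: (@ge0_integral_oy_le _ (fun x : R => - b^-1 * (1 + x) `^ (- b))).
- by move=> x _; exact: powR_ge0.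
- move=> x x0; apply: continuous_powR_comp; first by rewrite addr_gt0.
  by apply: continuousD; [exact: cvg_cst|exact: cvg_id].
- move=> x x0; have xc : 0 < 1 + x by rewrite addr_gt0.
  have Du : is_derive x 1 (fun y : R => 1 + y) 1.
    apply: is_derive_eq (is_deriveD (is_derive_cst (1 : R) x 1) (is_derive_id x 1)) _.
    by rewrite add0r.
  apply: is_derive_eq (is_derive_mull _ (is_derive_powR_comp (- b) Du xc)) _.
  rewrite /=  (addrC (- b)); field; rewrite gt_eqF//.
- move=> x x0; rewrite mulNr normrN ger0_norm ?mulr_ge0 ?powR_ge0 ?invr_ge0 ?(ltW b0)//.
  rewrite ler_piMr ?invr_ge0 ?(ltW b0)// -[leRHS](powRr0 (1 + x)) ler_powR; lra.
Qed.

End power_integrals.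

(** * The kernel of cos(kD)/k *)

Section cosine_kernel.
Variable R : realType.
Notation mu := (@lebesgue_measure R).

Lemma itv_cc_integrable (f : R -> R) (a b : R) :
  (forall x, a <= x <= b -> {for x, continuous f}) ->
  mu.-integrable `[a, b] (EFin \o f).
Proof.
move=> cf; apply: continuous_compact_integrable; first exact: segment_compact.
by apply: continuous_in_subspaceT => x; rewrite inE/= in_itv/=; exact: cf.
Qed.

Lemma Rintegral_FTC2 (P p : R -> R) (a b : R) : a < b ->
  (forall x, a <= x <= b -> {for x, continuous p}) ->
  (forall x, a <= x <= b -> is_derive x 1 P (p x)) ->
  \int[mu]_(x in `[a, b]) p x = P b - P a.
Proof.
move=> ab cp dP.
have cP x : a <= x <= b -> {for x, continuous P}.
  move=> /dP [D _]; apply: differentiable_continuous.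
  exact/derivable1_diffP.
rewrite /Rintegral (@continuous_FTC2 _ p P)//.
- by apply: continuous_in_subspaceT => x; rewrite inE/= in_itv/=; exact: cp.
- split.
  + move=> x; rewrite in_itv/= => hx.
    have /dP[] // : a <= x <= b by lra.
  + by apply: cvg_at_right_filter; apply: cP; lra.
  + by apply: cvg_at_left_filter; apply: cP; lra.
- move=> x; rewrite in_itv/= => hx.
  rewrite derive1E; apply: derive_val.
  by apply: dP; lra.
Qed.

(** This takes the place of integration by parts: P is an approximate primitive of f, and the error
    of its derivative is controlled by the exact primitive Q. *)
Lemma Rintegral_FTC2_approx (f P p Q q : R -> R) (a b : R) : a < b ->
  (forall x, a <= x <= b -> {for x, continuous f}) ->
  (forall x, a <= x <= b -> {for x, continuous p}) ->
  (forall x, a <= x <= b -> {for x, continuous q}) ->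
  (forall x, a <= x <= b -> is_derive x 1 P (p x)) ->
  (forall x, a <= x <= b -> is_derive x 1 Q (q x)) ->
  (forall x, a <= x <= b -> `|f x - p x| <= q x) ->
  `|\int[mu]_(x in `[a, b]) f x - (P b - P a)| <= Q b - Q a.
Proof.
move=> ab cf cp cq dP dQ fpq.
have If := itv_cc_integrable cf.
have Ip := itv_cc_integrable cp.
have Iq := itv_cc_integrable cq.
rewrite -(Rintegral_FTC2 ab cp dP) -(Rintegral_FTC2 ab cq dQ) -RintegralB//.
have Ifp : mu.-integrable `[a, b] (EFin \o (fun x => f x - p x)).
  by apply: itv_cc_integrable => x hx; apply: continuousB; [exact: cf|exact: cp].
apply: (le_trans (le_normr_Rintegral _ Ifp)) => //.
apply: le_Rintegral => //.
exact: integrable_norm Ifp.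
Qed.

Lemma continuous_cosV (D k : R) : 0 < k ->
  {for k, continuous (fun k : R => k^-1 * cos (k * D))}.
Proof.
move=> k0; apply: continuousM.
  by apply: continuousV; [rewrite gt_eqF|exact: cvg_id].
apply: (@continuous_comp _ _ _ (fun k : R => k * D) (@cos R)).
  by apply: continuousM; [exact: cvg_id|exact: cvg_cst].
exact: continuous_cos.
Qed.

Lemma Rintegral_cosV_tail (D m M : R) : 0 < D -> 0 < m -> m < M ->
  `|\int[mu]_(k in `[m, M]) (k^-1 * cos (k * D))| <= 2 / (m * D).
Proof.
move=> D0 m0 mM.
have k0 k : m <= k <= M -> 0 < k by move=> /andP[/(lt_le_trans m0)].
have cV k : m <= k <= M -> {for k, continuous (fun k : R => k^-1)}.
  by move=> /k0 h; apply: continuousV; [rewrite gt_eqF|exact: cvg_id].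
have cD (h : R -> R) k : continuous h -> {for k, continuous (fun k : R => h (k * D))}.
  move=> ch; apply: (@continuous_comp _ _ _ (fun k : R => k * D) h).
    by apply: continuousM; [exact: cvg_id|exact: cvg_cst].
  exact: ch.
have Dm (k : R) : is_derive k 1 (fun k : R => k * D) D.
  apply: is_derive_eq (is_deriveM (is_derive_id k (1 : R)) (is_derive_cst (D : R) k (1 : R))) _.
  by rewrite /GRing.scale/= mulr0 add0r mulr1.
have Ds (k : R) : is_derive k 1 (fun k : R => sin (k * D)) (cos (k * D) * D).
  exact: (@is_derive1_comp _ (@sin R) (fun k : R => k * D) _ _ _
    (is_derive_sin (k * D)) (Dm k)).
have DV (k : R) : m <= k <= M -> is_derive k 1 (fun k : R => k^-1) (- k ^- 2).
  move=> /k0 h.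
  have k1 : id k != 0 by rewrite gt_eqF.
  apply: is_derive_eq (is_deriveV k1 (is_derive_id k (1 : R))) _.
  by rewrite /GRing.scale/= mulr1.
(* P is the boundary term of the integration by parts and q bounds the remainder sin (k * D) / (D *
   k^2). In the final sum |P M| <= 1 / (D * M) is compensated by Q M = - 1 / (D * M), which leaves 2
   / (m * D) for every M. *)
pose P (k : R) := D^-1 * (sin (k * D) * k^-1).
pose p (k : R) := k^-1 * cos (k * D) - D^-1 * (sin (k * D) * (k^-1 * k^-1)).
pose Q (k : R) := (- D^-1) * k^-1.
pose q (k : R) := D^-1 * (k^-1 * k^-1).
have := @Rintegral_FTC2_approx (fun k => k^-1 * cos (k * D)) P p Q q m M mM.
move=> /(_ _ _ _ _ _ _)H.
have {H} : `|\int[mu]_(x in `[m, M]) (x^-1 * cos (x * D)) - (P M - P m)| <= Q M - Q m.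
  apply: H => k hk; have kp := k0 _ hk.
  - exact: continuous_cosV.
  - apply: continuousB; first exact: continuous_cosV.
    apply: continuousM; first exact: cvg_cst.
    apply: continuousM; last by apply: continuousM; exact: cV.
    exact/cD/continuous_sin.
  - apply: continuousM; first exact: cvg_cst.
    by apply: continuousM; exact: cV.
  - apply: is_derive_eq (is_derive_mull _ (is_deriveM (Ds k) (DV k hk))) _.
    rewrite /p /GRing.scale/=; field; rewrite ?gt_eqF//.
  - apply: is_derive_eq (is_derive_mull _ (DV k hk)) _.
    rewrite /q; field; rewrite ?gt_eqF//.
  - rewrite /p opprB addrCA subrr addr0 normrM gtr0_norm ?invr_gt0//.
    rewrite ler_pM2l ?invr_gt0// normrM [X in _ * X]ger0_norm ?mulr_ge0 ?invr_ge0 ?(ltW kp)//.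
    by rewrite ler_piMl ?mulr_ge0 ?invr_ge0 ?(ltW kp)// sin_max.
have PB k : m <= k <= M -> `|P k| <= D^-1 * k^-1.
  move=> hk; have kp := k0 _ hk.
  rewrite /P normrM gtr0_norm ?invr_gt0// ler_pM2l ?invr_gt0// normrM.
  rewrite [X in _ * X]gtr0_norm ?invr_gt0// ler_piMl ?invr_ge0 ?(ltW kp)//.
  exact: sin_max.
have := PB M; have := PB m; rewrite !lexx (ltW mM) => /(_ isT) + /(_ isT).
rewrite /Q (_ : 2 / (m * D) = 2 * (D^-1 * m^-1)); last by field; rewrite !gt_eqF.
set x := Rintegral _ _ _; set u := D^-1 * m^-1.
rewrite mulNr mulNr -/u; set v := D^-1 * M^-1.
rewrite !ler_norml; lra.
Qed.

(* Split at k = 1/|D|: bound cos by 1 before it, integrate by parts after it. *)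
Lemma Rintegral_cosV (D M T : R) : D != 0 -> 1 < M -> 0 <= T -> ln `|D|^-1 <= T ->
  `|\int[mu]_(k in `[1, M]) (k^-1 * cos (k * D))| <= 2 + T.
Proof.
wlog D0 : D / 0 < D => [hwlog|].
  move=> Dn0; have [D0|D0|D0] := ltgtP D 0.
  - move: (hwlog (- D)); rewrite oppr_gt0 oppr_eq0 normrN => /(_ D0 Dn0) h M1 T0 lT.
    have := h M1 T0 lT.
    by under eq_Rintegral do rewrite mulrN cosN.
  - by apply: hwlog.
  - by rewrite D0 eqxx in Dn0.
move=> _ M1 T0; rewrite (gtr0_norm D0) => lT.
have small m : 1 < m -> m <= D^-1 ->
    `|\int[mu]_(k in `[1, m]) (k^-1 * cos (k * D))| <= T.
  move=> m1 mD.
  have := @Rintegral_FTC2_approx (fun k => k^-1 * cos (k * D)) (cst 0) (cst 0)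
    (@ln R) (fun k => k^-1) 1 m m1.
  rewrite /= subrr subr0 ln1 subr0 => H; apply: le_trans (H _ _ _ _ _ _) _.
  - by move=> x hx; apply: continuous_cosV; lra.
  - by move=> x _; exact: cvg_cst.
  - by move=> x hx; apply: continuousV; [rewrite gt_eqF//; lra|exact: cvg_id].
  - by move=> x hx; apply: is_derive1_ln; lra.
  - move=> x hx; rewrite subr0 normrM gtr0_norm ?invr_gt0; last lra.
    by rewrite ler_piMr ?cos_max// invr_ge0; lra.
  - by apply: le_trans lT; rewrite ler_ln ?posrE ?invr_gt0//; lra.
have [MD|DM] := leP M D^-1; first by rewrite (le_trans (small _ M1 MD))// lerDr.
have [D1|D1] := leP D^-1 1.
  apply: le_trans (Rintegral_cosV_tail D0 ltr01 M1) _.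
  rewrite mul1r; apply: (@le_trans _ _ 2); last by rewrite lerDl.
  by rewrite ler_piMr.
have If : mu.-integrable `[1, M] (EFin \o (fun k => k^-1 * cos (k * D))).
  by apply: itv_cc_integrable => x hx; apply: continuous_cosV; lra.
have := @Rintegral_itvB R _ (BLeft 1) (BRight M) D^-1 If.
rewrite !bnd_simp (ltW D1) (ltW DM) => /(_ isT isT).
rewrite Rintegral_itv_obnd_cbnd; last first.
  apply: integrableS If => //; apply: subset_itvr; rewrite bnd_simp; exact: ltW.
move/eqP; rewrite subr_eq => /eqP ->.
apply: le_trans (ler_normD _ _) _; apply: lerD; last exact: small.
apply: le_trans (Rintegral_cosV_tail D0 _ DM) _; first by rewrite invr_gt0.
by rewrite mulVf ?gt_eqF// divr1.
Qed.

End cosine_kernel.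

(** * Logarithmic bound for the kernel in the variable x(y) *)

Section xmap_kernel.
Variable R : realType.
Notation mu := (@lebesgue_measure R).

Definition sqrt_pos (y : R) : R := Num.sqrt (Num.max 0 y).

(* |x - c|^(-1/2), cut off at distance 1 and set to 0 at x = c. *)
Definition inv_sqrt_dist (c : R) : R -> R :=
  ((fun x => (x - c) `^ (2^-1 - 1)) \_ `]c, (c + 1)%R[) \+
  ((fun x => (c - x) `^ (2^-1 - 1)) \_ `](c - 1)%R, c[).

(** With d = z - y, the inequality ln r <= r - 1 for r = (1 + e^(-z)) / (1 + e^(-y)) bounds the gap
    below by (1 - e^(-d)) / (1 + e^y). The numerator is at least d / (1 + d) >= min(1, d) / 2 and
    the denominator at most 2 e^(y^+), whence the 4. *)
Lemma xmap_gap (y z : R) : y < z ->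
  Num.min 1 (z - y) / (4 * expR (Num.max 0 y)) <= xmap z - xmap y.
Proof.
move=> yz; rewrite /xmap.
set d := z - y; have d0 : 0 < d by rewrite subr_gt0.
have eyp : 0 < expR (- y) := expR_gt0 _.
have ezp : 0 < expR (- z) := expR_gt0 _.
have A0 : 0 < 1 + expR (- y) by rewrite addr_gt0.
have B0 : 0 < 1 + expR (- z) by rewrite addr_gt0.
have h1 : ln (1 + expR (- z)) - ln (1 + expR (- y)) <=
    (1 + expR (- z)) / (1 + expR (- y)) - 1.
  rewrite -ln_div ?posrE//.
  set r := _ / _; have r0 : 0 < r by rewrite divr_gt0.
  rewrite -[in leLHS](subrKC 1 r); apply: le_ln1Dx; lra.
have h2 : 1 - (1 + expR (- z)) / (1 + expR (- y)) = (1 - expR (- d)) / (1 + expR y).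
  have -> : expR (- z) = expR (- d) / expR y.
    by rewrite -expRN -expRD; congr expR; rewrite /d; ring.
  rewrite !expRN; have ey := expR_gt0 y; have ed := expR_gt0 d; field.
  by repeat (apply/andP; split); rewrite gt_eqF//; lra.
set m := Num.min 1 d.
have m0 : 0 < m by rewrite lt_min ltr01.
have h3 : m / 2 <= 1 - expR (- d).
  have : expR (- d) <= (1 + d)^-1.
    have := expR_ge1Dx d; rewrite expRN lef_pV2 ?posrE ?expR_gt0//; lra.
  have : m / 2 <= 1 - (1 + d)^-1.
    have -> : 1 - (1 + d)^-1 = d / (1 + d) by field; rewrite gt_eqF //; lra.
    rewrite ler_pdivlMr; last lra.
    have m1 : m <= 1 by rewrite ge_min lexx.
    have md : m <= d by rewrite ge_min lexx orbT.
    nra.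
  by move=> h h'; apply: (le_trans h); rewrite lerD2l lerN2.
have h4 : 1 + expR y <= 2 * expR (Num.max 0 y).
  have : expR y <= expR (Num.max 0 y) by rewrite ler_expR le_max lexx orbT.
  have : 1 <= expR (Num.max 0 y) by rewrite -expR0 ler_expR le_max lexx.
  lra.
have h5 : m / (4 * expR (Num.max 0 y)) <= (1 - expR (- d)) / (1 + expR y).
  have -> : m / (4 * expR (Num.max 0 y)) = m / 2 * (2 * expR (Num.max 0 y))^-1.
    by field; rewrite gt_eqF ?expR_gt0.
  apply: ler_pM; rewrite ?divr_ge0 ?invr_ge0 ?mulr_ge0 ?expR_ge0 ?(ltW m0)//.
  rewrite lef_pV2 ?posrE ?mulr_gt0 ?addr_gt0 ?expR_gt0//.
lra.
Qed.

(** With m = min(1, z - y), the identity - ln m = 2 ln (m^(-1/2)) and ln t < t trade the logarithmic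
    singularity for a power with an elementary integral. The exponent is written 2^-1 - 1 to fit the
    power integrals at a = 1/2. The constant 4 collects ln 4 <= 2 and 2 * 1 from m^(-1/2) when z - y
    >= 1. *)
Lemma ln_xmap_gap (y z : R) : y < z ->
  ln `|xmap z - xmap y|^-1 <= 4 + sqrt_pos y * sqrt_pos z +
    2 * (if z - y < 1 then (z - y) `^ (2^-1 - 1) else 0).
Proof.
move=> yz; have gap := xmap_gap yz.
set d := z - y; have d0 : 0 < d by rewrite subr_gt0.
set m := Num.min 1 d.
have m0 : 0 < m by rewrite lt_min ltr01.
have e0 : 0 < expR (Num.max 0 y) := expR_gt0 _.
have g0 : 0 < m / (4 * expR (Num.max 0 y)) by rewrite divr_gt0 ?mulr_gt0.
have x0 : 0 < xmap z - xmap y := lt_le_trans g0 gap.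
rewrite gtr0_norm// lnV ?posrE//.
have h1 : ln m - (ln 4 + Num.max 0 y) <= ln (xmap z - xmap y).
  have -> : ln 4 + Num.max 0 y = ln (4 * expR (Num.max 0 y)).
    by rewrite lnM ?posrE// expRK.
  rewrite -ln_div ?posrE ?mulr_gt0//.
  by rewrite ler_ln ?posrE.
have h2 : ln 4 <= 2 :> R.
  have -> : 4 = 2 * 2 :> R by ring.
  rewrite lnM ?posrE//.
  have : ln (1 + 1) <= 1 :> R by apply: le_ln1Dx; lra.
  rewrite (_ : 1 + 1 = 2 :> R)//; lra.
have h3 : Num.max 0 y <= sqrt_pos y * sqrt_pos z.
  rewrite -[leLHS]sqr_sqrtr ?le_max ?lexx// expr2.
  apply: ler_wpM2l; first exact: sqrtr_ge0.
  by apply: ler_wsqrtr; rewrite ge_max !le_max lexx (ltW yz) orbT.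
have h4 : - ln m <= 2 * m `^ (2^-1 - 1).
  have := @ln_sublinear R (m `^ (2^-1 - 1)) (powR_gt0 _ m0); rewrite ln_powR; lra.
have h5 : m `^ (2^-1 - 1) <= 1 + (if d < 1 then d `^ (2^-1 - 1) else 0).
  rewrite /m; have [d1|d1] := ltP d 1.
    by rewrite lerDr.
  by rewrite powR1 addr0.
lra.
Qed.

(** Cosine is even, so [main] only treats an ordered pair; 6 is the 2 of [Rintegral_cosV] plus the 4
    of [ln_xmap_gap]. *)
Lemma Rintegral_cosV_xmap (M y z : R) : 1 < M -> z != y ->
  `|\int[mu]_(k in `[1, M]) (k^-1 * cos (k * (xmap y - xmap z)))| <=
  6 + sqrt_pos y * sqrt_pos z + 2 * inv_sqrt_dist y z.
Proof.
move=> M1 zy.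
have main u v (I : R) : u < v -> I = (if v - u < 1 then (v - u) `^ (2^-1 - 1) else 0) ->
   `|\int[mu]_(k in `[1, M]) (k^-1 * cos (k * (xmap v - xmap u)))| <=
    6 + sqrt_pos u * sqrt_pos v + 2 * I.
  move=> uv ->.
  have -> : 6 = 2 + 4 :> R by ring.
  rewrite -2!addrA; apply: Rintegral_cosV => //.
  - rewrite gt_eqF//; apply: lt_le_trans (xmap_gap uv).
    by rewrite divr_gt0 ?lt_min ?ltr01 ?subr_gt0 ?mulr_gt0 ?expR_gt0.
  - rewrite !addr_ge0 ?mulr_ge0 ?sqrtr_ge0//; case: ifP => // _; exact: powR_ge0.
  - by rewrite addrA; exact: ln_xmap_gap.
move: zy; rewrite neq_lt => /orP[zy|yz].
- rewrite (mulrC (sqrt_pos y)); apply: main => //.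
  rewrite /inv_sqrt_dist /= !patchE !mem_setE !in_itv/= (lt_gtF zy)/= add0r zy andbT.
  by rewrite ltrBlDr -ltrBlDl.
- under eq_Rintegral do rewrite -cosN -mulrN opprB.
  apply: main => //.
  rewrite /inv_sqrt_dist /= !patchE !mem_setE !in_itv/= (lt_gtF yz)/= andbF addr0 yz.
  by rewrite ltrBlDl.
Qed.

End xmap_kernel.

(** * Fubini for oscillatory integrals *)

Section fubini.
Variable R : realType.
Notation mu := (@lebesgue_measure R).

Lemma integrable_measurable (f : R -> R) :
  mu.-integrable setT (EFin \o f) -> measurable_fun setT f.
Proof. by case/integrableP => /measurable_EFinP. Qed.

Lemma EFin_RintegralT (f : R -> R) : mu.-integrable setT (EFin \o f) ->
  (\int[mu]_(y in setT) f y)%:E = (\int[mu]_(y in setT) (f y)%:E)%E.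
Proof. by move=> fi; rewrite fineK// integrable_fin_num. Qed.

Lemma integrable_mul_bounded (b h : R -> R) :
  mu.-integrable setT (EFin \o b) -> measurable_fun setT h ->
  (forall y, `|h y| <= 1) -> mu.-integrable setT (EFin \o (fun y => b y * h y)).
Proof.
move=> ib mh h1; have mb := integrable_measurable ib.
apply: le_integrable ib => //; first by apply/measurable_EFinP; exact: measurable_funM.
by move=> y _; rewrite /= lee_fin normrM ler_piMr.
Qed.

Section swap.
Variables (a b : R -> R) (c : R * R -> R).
Hypotheses (ia : mu.-integrable setT (EFin \o a)).
Hypotheses (ib : mu.-integrable setT (EFin \o b)).
Hypotheses (mc : measurable_fun setT c) (c1 : forall z, `|c z| <= 1).

Let ma : measurable_fun setT a. Proof. exact: integrable_measurable ia. Qed.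
Let mb : measurable_fun setT b. Proof. exact: integrable_measurable ib. Qed.

Let f (z : R * R) := (a z.1 * (b z.2 * c z))%:E.

Let mf : measurable_fun setT f.
Proof.
apply/measurable_EFinP; apply: measurable_funM; first exact: measurableT_comp.
by apply: measurable_funM => //; exact: measurableT_comp.
Qed.

Let bc k : mu.-integrable setT (EFin \o (fun y => b y * c (k, y))).
Proof.
apply: integrable_mul_bounded => //.
exact: (measurableT_comp mc (measurable_pair1 k)).
Qed.

Let ac y : mu.-integrable setT (EFin \o (fun k => a k * c (k, y))).
Proof.
apply: integrable_mul_bounded => //.
exact: (measurableT_comp mc (measurable_pair2 y)).
Qed.

(** Since |c| <= 1, the integrand is dominated by |a k| |b y|, whose iterated integral is a product
    of two finite ones. *)
Lemma integrable_swap_prod : (mu \x mu)%E.-integrable setT f.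
Proof.
apply/integrable12ltyP => //.
have ib' := integrable_norm ib.
pose B := \int[mu]_(y in setT) `|b y|.
have iaB : mu.-integrable setT (EFin \o (fun k => `|a k| * B)).
  by have := integrableZr measurableT B (integrable_norm ia).
apply: (@le_lt_trans _ _ (\int[mu]_k (`|a k| * B)%:E)%E).
  apply: ge0_le_integral => //.
  - by move=> k _; exact: integral_ge0.
  - have mf' : measurable_fun setT (fun z => `|f z|)%E by exact: measurableT_comp.
    exact: (@measurable_fun_fubini_tonelli_F _ _ _ _ R mu (fun z => `|f z|)%E mf'
      (fun z => abse_ge0 _)).
  - by apply/measurable_EFinP; exact: (integrable_measurable iaB).
  move=> k _; rewrite -RintegralZl// EFin_RintegralT; last first.
    by have := integrableZl measurableT `|a k| ib'.
  apply: ge0_le_integral => //.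
  - by apply: measurableT_comp => //; exact: measurableT_comp.
  - apply/measurable_EFinP; apply: measurable_funM => //.
    exact: measurableT_comp.
  move=> y _; rewrite lee_fin !normrM ler_wpM2l// ler_piMr//.
by rewrite -EFin_RintegralT ?ltry.
Qed.

Lemma swap_inner_y k :
  (\int[mu]_y f (k, y) = (a k * \int[mu]_(y in setT) (b y * c (k, y)))%:E)%E.
Proof.
rewrite EFinM EFin_RintegralT; last exact: bc.
by rewrite -integralZl//; exact: bc.
Qed.

Lemma swap_inner_k y :
  (\int[mu]_k f (k, y) = (b y * \int[mu]_(k in setT) (a k * c (k, y)))%:E)%E.
Proof.
rewrite EFinM EFin_RintegralT; last exact: ac.
rewrite -integralZl//; last exact: ac.
apply: eq_integral => k _.
by rewrite -EFinM /f/= mulrCA.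
Qed.

Lemma integrable_swap_l :
  mu.-integrable setT (EFin \o (fun k => a k * \int[mu]_(y in setT) (b y * c (k, y)))).
Proof.
have := integrable_fubini_F integrable_swap_prod; congr (integrable _ _ _).
by apply/funext => k; exact: swap_inner_y.
Qed.

End swap.

Lemma integrable_swap_r (a b : R -> R) (c : R * R -> R) :
  mu.-integrable setT (EFin \o a) -> mu.-integrable setT (EFin \o b) ->
  measurable_fun setT c -> (forall z, `|c z| <= 1) ->
  mu.-integrable setT (EFin \o (fun y => b y * \int[mu]_(k in setT) (a k * c (k, y)))).
Proof.
move=> ia ib mc c1.
apply: (@integrable_swap_l b a (fun z => c (z.2, z.1))) => //.
apply: measurableT_comp => //; exact: measurable_fun_pair.
Qed.

Lemma Rintegral_swap (a b : R -> R) (c : R * R -> R) :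
  mu.-integrable setT (EFin \o a) -> mu.-integrable setT (EFin \o b) ->
  measurable_fun setT c -> (forall z, `|c z| <= 1) ->
  \int[mu]_(k in setT) (a k * \int[mu]_(y in setT) (b y * c (k, y))) =
  \int[mu]_(y in setT) (b y * \int[mu]_(k in setT) (a k * c (k, y))).
Proof.
move=> ia ib mc c1.
apply: EFin_inj; rewrite !EFin_RintegralT;
  [|exact: integrable_swap_r ia ib mc c1|exact: integrable_swap_l].
under eq_integral do rewrite -(swap_inner_y a ib mc c1).
under [RHS]eq_integral do rewrite -(swap_inner_k b ia mc c1).
exact: Fubini (integrable_swap_prod ia ib mc c1).
Qed.


(** The phase x stays general: [xmap] serves the created particles and [id] the ordinary Fourier
    transform. *)
Definition cosint g x k : R := \int[mu]_(y in setT) (g y * cos (k * x y)).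
Definition sinint g x k : R := \int[mu]_(y in setT) (g y * sin (k * x y)).

Section energy.
Variables (g x w : R -> R).
Hypotheses (ig : mu.-integrable setT (EFin \o g)) (mx : measurable_fun setT x).
Hypothesis (iw : mu.-integrable setT (EFin \o w)).

Lemma measurable_phase_prod (h : R -> R) : continuous h ->
  measurable_fun setT (fun z : R * R => h (z.1 * x z.2)).
Proof.
move=> ch; apply: measurableT_comp; first exact: continuous_measurable_fun.
by apply: measurable_funM => //; exact: measurableT_comp.
Qed.

Let ccos := measurable_phase_prod (@continuous_cos R).
Let csin := measurable_phase_prod (@continuous_sin R).
Let cos1 (z : R * R) : `|cos (z.1 * x z.2)| <= 1 := cos_max _.
Let sin1 (z : R * R) : `|sin (z.1 * x z.2)| <= 1 := sin_max _.

Lemma measurable_phase (h : R -> R) k : continuous h ->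
  measurable_fun setT (fun y => h (k * x y)).
Proof.
move=> ch; apply: measurableT_comp; first exact: continuous_measurable_fun.
exact: measurable_funM.
Qed.

Lemma integrable_cosint k : mu.-integrable setT (EFin \o (fun y => g y * cos (k * x y))).
Proof.
apply: integrable_mul_bounded => //; first exact: measurable_phase (@continuous_cos R).
by move=> y; exact: cos_max.
Qed.

Lemma integrable_sinint k : mu.-integrable setT (EFin \o (fun y => g y * sin (k * x y))).
Proof.
apply: integrable_mul_bounded => //; first exact: measurable_phase (@continuous_sin R).
by move=> y; exact: sin_max.
Qed.

(* |F|^2 = \int\int g(y) g(z) cos(k (x(y) - x(z))), integrated against w. *)
Lemma energy_kernel :
  [/\ mu.-integrable setT (EFin \o (fun k => w k * (cosint g x k ^+ 2 + sinint g x k ^+ 2))),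
    mu.-integrable setT (EFin \o (fun y => g y * \int[mu]_(z in setT)
      (g z * \int[mu]_(k in setT) (w k * cos (k * (x y - x z)))))) &
    \int[mu]_(k in setT) (w k * (cosint g x k ^+ 2 + sinint g x k ^+ 2)) =
    \int[mu]_(y in setT) (g y * \int[mu]_(z in setT)
      (g z * \int[mu]_(k in setT) (w k * cos (k * (x y - x z)))))].
Proof.
have ic : mu.-integrable setT (EFin \o (fun k => w k * cosint g x k)) :=
  integrable_swap_l iw ig ccos cos1.
have is' : mu.-integrable setT (EFin \o (fun k => w k * sinint g x k)) :=
  integrable_swap_l iw ig csin sin1.
(* One factor of each square is absorbed into the weight, which [ic] and [is'] show to be
   integrable; only the other is opened as an integral. The triple integral thus reduces to
   exchanges of two variables. *)
have EL : (fun k => w k * (cosint g x k ^+ 2 + sinint g x k ^+ 2)) =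
    (fun k => w k * cosint g x k * \int[mu]_(y in setT) (g y * cos (k * x y)) +
      w k * sinint g x k * \int[mu]_(y in setT) (g y * sin (k * x y))).
  by apply/funext => k; rewrite -/(cosint g x k) -/(sinint g x k); ring.
have ER : (fun y => g y * \int[mu]_(z in setT)
      (g z * \int[mu]_(k in setT) (w k * cos (k * (x y - x z))))) =
    (fun y => g y * \int[mu]_(k in setT) (w k * cosint g x k * cos (k * x y)) +
      g y * \int[mu]_(k in setT) (w k * sinint g x k * sin (k * x y))).
  apply/funext => y; rewrite -mulrDr; congr (_ * _).
  have mk (h : R -> R) : continuous h -> measurable_fun setT (fun k : R => h (k * x y)).
    move=> ch; apply: measurableT_comp; first exact: continuous_measurable_fun.
    exact: measurable_funM.
  rewrite -RintegralD//; last 2 first.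
  - apply: integrable_mul_bounded => //; first exact: mk (@continuous_cos R).
    by move=> k; exact: cos_max.
  - apply: integrable_mul_bounded => //; first exact: mk (@continuous_sin R).
    by move=> k; exact: sin_max.
  have md : measurable_fun setT (fun z : R * R => cos (z.1 * (x y - x z.2))).
    apply: measurableT_comp; first exact: (continuous_measurable_fun (@continuous_cos R)).
    apply: measurable_funM => //; apply: measurable_funB => //; exact: measurableT_comp.
  have := Rintegral_swap iw ig md (fun z => cos_max _) => /= <-.
  apply: eq_Rintegral => k _.
  rewrite -!mulrA -mulrDr; congr (_ * _).
  rewrite mulrC [X in _ + X]mulrC -!RintegralZl//;
    [|exact: integrable_sinint|exact: integrable_cosint].
  rewrite -RintegralD//; last 2 first.
  - by have := integrableZl measurableT (cos (k * x y)) (integrable_cosint k).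
  - by have := integrableZl measurableT (sin (k * x y)) (integrable_sinint k).
  by apply: eq_Rintegral => z _; rewrite mulrBr cosB; ring.
have icl := integrable_swap_l ic ig ccos cos1.
have isl := integrable_swap_l is' ig csin sin1.
have icr := integrable_swap_r ic ig ccos cos1.
have isr := integrable_swap_r is' ig csin sin1.
rewrite EL ER; split.
- by have := integrableD measurableT icl isl.
- by have := integrableD measurableT icr isr.
- rewrite (RintegralD _ icl isl)// (RintegralD _ icr isr)//.
  by rewrite (Rintegral_swap ic ig ccos cos1) (Rintegral_swap is' ig csin sin1).
Qed.

End energy.
End fubini.

(** For real g this is |\int g(y) e^(i k x(y)) dy|^2, free of the factor [fnorm]. *)
Local Notation energy g x k := (cosint g x k ^+ 2 + sinint g x k ^+ 2).

(** * Large frequencies *)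

Section large_frequencies.
Variable R : realType.
Notation mu := (@lebesgue_measure R).

Lemma measurable_xmap : measurable_fun setT (@xmap R).
Proof.
rewrite /xmap; apply: measurableT_comp => //; apply: measurableT_comp => //.
by apply: measurable_funD => //; apply: measurableT_comp => //; exact: oppr_measurable.
Qed.

(* The transform is measurable because its product with an integrable positive
   weight is a Fubini marginal. *)
Lemma measurable_phase_integral (g x : R -> R) (h : R -> R) :
  mu.-integrable setT (EFin \o g) -> measurable_fun setT x ->
  continuous h -> (forall t, `|h t| <= 1) ->
  measurable_fun setT (fun k : R => \int[mu]_(y in setT) (g y * h (k * x y))).
Proof.
move=> ig mx ch h1.
have I := integrable_swap_l (integrable_decay (ltr01 : 0 < 1 :> R)) ig
  (measurable_phase_prod mx ch) (fun z => h1 _).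
(* The exponent -1 - (-3) = 2 undoes the integrable weight of exponent -1 - 1 = -2. *)
have -> : (fun k => \int[mu]_(y in setT) (g y * h (k * x y))) =
    (fun k : R => (1 + `|k|) `^ (-1 - (-3)) * ((1 + `|k|) `^ (-1 - 1) *
      \int[mu]_(y in setT) (g y * h (k * x y)))).
  apply/funext => k; rewrite mulrA -powRD; last first.
    by apply/implyP => _; rewrite gt_eqF// ltr_pwDl.
  by rewrite (_ : -1 - -3 + (-1 - 1) = 0) ?powRr0 ?mul1r//; ring.
apply: measurable_funM; last exact: (integrable_measurable I).
exact: (continuous_measurable_fun (@continuous_decay R (-3))).
Qed.

Lemma measurable_inv_pos :
  measurable_fun (`]0%R, +oo[%classic : set R) (fun k : R => k^-1).
Proof.
apply: open_continuous_measurable_fun => // k; rewrite inE/= in_itv/= andbT => k0.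
by apply: continuousV; [rewrite gt_eqF|exact: cvg_id].
Qed.

Lemma le_Rintegral_setT (f h : R -> R) :
  mu.-integrable setT (EFin \o f) -> mu.-integrable setT (EFin \o h) ->
  (forall z, f z <= h z) ->
  \int[mu]_(z in setT) f z <= \int[mu]_(z in setT) h z.
Proof. by move=> If Ih fh; apply: le_Rintegral. Qed.

Lemma le_Rintegral_setD1 (f h : R -> R) (y : R) :
  mu.-integrable setT (EFin \o f) -> mu.-integrable setT (EFin \o h) ->
  (forall z, z != y -> f z <= h z) ->
  \int[mu]_(z in setT) f z <= \int[mu]_(z in setT) h z.
Proof.
move=> If Ih fh.
have mD : measurable ([set: R] `\ y) by exact: measurableD.
have E (q : R -> R) : mu.-integrable setT (EFin \o q) ->
    \int[mu]_(z in setT) q z = \int[mu]_(z in setT `\ y) q z.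
  move=> Iq; rewrite /Rintegral integral_setD1//.
  by apply/measurable_EFinP; apply: measurable_funTS; exact: (integrable_measurable Iq).
rewrite !E//; apply: le_Rintegral => //.
- exact: integrableS If.
- exact: integrableS Ih.
- by move=> z [_ /eqP zy]; exact: fh.
Qed.

Lemma integrable_restrictT (D : set R) (f : R -> R) : measurable D ->
  mu.-integrable D (EFin \o f) -> mu.-integrable setT (EFin \o (f \_ D)).
Proof.
by move=> mD If; rewrite -restrict_EFin; exact: (@integrable_mkcond _ _ R mu D (EFin \o f) mD).1.
Qed.

Lemma inv_sqrt_dist_ge0 (c y : R) : 0 <= inv_sqrt_dist c y.
Proof.
by rewrite /inv_sqrt_dist/= addr_ge0// patchE; case: ifP => // _; exact: powR_ge0.
Qed.

(** Each side contributes at most a^-1 + a^-1 = 4 for a = 1/2. What matters is that the bound is the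
    same for every c. *)
Lemma integrable_inv_sqrt_dist (c : R) :
  mu.-integrable setT (EFin \o inv_sqrt_dist c) /\
  \int[mu]_(y in setT) inv_sqrt_dist c y <= 8.
Proof.
have piece (a b : R) (h : R -> R) :
    (forall x, a < x < b -> {for x, continuous h}) -> (forall x, 0 <= h x) ->
    (\int[mu]_(x in `]a, b[) (h x)%:E <= (2^-1^-1 + 2^-1^-1)%:E)%E ->
    mu.-integrable setT (EFin \o (h \_ `]a, b[)) /\
    \int[mu]_(x in setT) (h \_ `]a, b[) x <= 4.
  move=> ch h0 hI.
  have Ih : mu.-integrable `]a, b[ (EFin \o h).
    apply/integrableP; split.
      apply/measurable_EFinP; apply: open_continuous_measurable_fun => // x.
      by rewrite inE/= in_itv/=; exact: ch.
    under eq_integral do rewrite /= ger0_norm//.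
    exact: le_lt_trans hI (ltry _).
  split; first exact: integrable_restrictT.
  rewrite -Rintegral_mkcond -lee_fin fineK ?integrable_fin_num//.
  by apply: le_trans hI _; rewrite lee_fin invrK; lra.
have [I1 B1] :
    mu.-integrable setT (EFin \o ((fun x => (x - c) `^ (2^-1 - 1)) \_ `]c, (c + 1)%R[)) /\
    \int[mu]_(x in setT) ((fun x => (x - c) `^ (2^-1 - 1)) \_ `]c, (c + 1)%R[) x <= 4.
  apply: piece => //.
  - move=> x /andP[cx _]; apply: continuous_powR_comp; first by rewrite subr_gt0.
    by apply: continuousB; [exact: cvg_id|exact: cvg_cst].
  - by move=> x; exact: powR_ge0.
  - by apply: integral_powR_right; rewrite invr_gt0.
have [I2 B2] :
    mu.-integrable setT (EFin \o ((fun x => (c - x) `^ (2^-1 - 1)) \_ `](c - 1)%R, c[)) /\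
    \int[mu]_(x in setT) ((fun x => (c - x) `^ (2^-1 - 1)) \_ `](c - 1)%R, c[) x <= 4.
  apply: piece => //.
  - move=> x /andP[_ cx]; apply: continuous_powR_comp; first by rewrite subr_gt0.
    by apply: continuousB; [exact: cvg_cst|exact: cvg_id].
  - by move=> x; exact: powR_ge0.
  - by apply: integral_powR_left; rewrite invr_gt0.
split; first by have := integrableD measurableT I1 I2.
by rewrite RintegralD// (_ : 8 = 4 + 4 :> R); [exact: lerD|ring].
Qed.

Section large.
Variables (g : R -> R) (D : R).
Hypotheses (ig : mu.-integrable setT (EFin \o g)) (gD : forall y, `|g y| <= D).
Hypothesis (igs : mu.-integrable setT (EFin \o (fun y => `|g y| * sqrt_pos y))).

Let S := \int[mu]_(y in setT) (`|g y| * sqrt_pos y).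
Let N := \int[mu]_(y in setT) `|g y|.
(** The cut at M makes 1/k integrable, as the exchange of integrals requires. *)
Let w (M : R) : R -> R := (fun k : R => k^-1) \_ `[1, M].
Let K M y z := \int[mu]_(k in setT) (w M k * cos (k * (xmap y - xmap z))).

Let w_integrable M : mu.-integrable setT (EFin \o w M).
Proof.
apply: integrable_restrictT => //.
apply: itv_cc_integrable => x /andP[x1 _].
by apply: continuousV; [rewrite gt_eqF// (lt_le_trans ltr01)|exact: cvg_id].
Qed.

Let K_le M y z : 1 < M -> z != y ->
  `|K M y z| <= 6 + sqrt_pos y * sqrt_pos z + 2 * inv_sqrt_dist y z.
Proof.
move=> M1 zy; have := Rintegral_cosV_xmap M1 zy.
rewrite Rintegral_mkcond; congr (`|_| <= _); apply: eq_Rintegral => k _.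
by rewrite /w !patchE; case: ifP => _//; rewrite mul0r.
Qed.

Let gK_integrable M y : mu.-integrable setT (EFin \o (fun z => g z * K M y z)).
Proof.
have md : measurable_fun setT (fun z : R * R => cos (z.1 * (xmap y - xmap z.2))).
  apply: measurableT_comp; first exact: (continuous_measurable_fun (@continuous_cos R)).
  apply: measurable_funM => //; apply: measurable_funB => //.
  by apply: measurableT_comp => //; exact: measurable_xmap.
exact: (integrable_swap_r (w_integrable M) ig md (fun z => cos_max _)).
Qed.

(** Each term of the kernel bound meets its own hypothesis on g: the constant 6 its integrability,
    the square roots the half moment, and the singular term the bound D, with 16 = 2 * 8. *)
Let inner_le M y : 1 < M ->
  `|\int[mu]_(z in setT) (g z * K M y z)| <= 6 * N + 16 * D + sqrt_pos y * S.
Proof.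
move=> M1; apply: le_trans (le_normr_Rintegral _ (gK_integrable M y)) _ => //.
have [I8 B8] := integrable_inv_sqrt_dist y.
have ia := integrable_norm ig.
have i1 : mu.-integrable setT (EFin \o (fun z => 6 * `|g z|)).
  by have := integrableZl measurableT 6 ia.
have i2 : mu.-integrable setT (EFin \o (fun z => sqrt_pos y * (`|g z| * sqrt_pos z))).
  by have := integrableZl measurableT (sqrt_pos y) igs.
have i3 : mu.-integrable setT (EFin \o (fun z => 2 * D * inv_sqrt_dist y z)).
  by have := integrableZl measurableT (2 * D) I8.
have i12 : mu.-integrable setT (EFin \o
    (fun z => 6 * `|g z| + sqrt_pos y * (`|g z| * sqrt_pos z))).
  by have := integrableD measurableT i1 i2.
have i123 : mu.-integrable setT (EFin \o (fun z => 6 * `|g z| +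
    sqrt_pos y * (`|g z| * sqrt_pos z) + 2 * D * inv_sqrt_dist y z)).
  by have := integrableD measurableT i12 i3.
apply: le_trans
  (le_Rintegral_setD1 (y := y) (integrable_norm (gK_integrable M y)) i123 _) _.
  move=> z zy /=; rewrite normrM.
  apply: le_trans (ler_wpM2l (normr_ge0 _) (K_le M1 zy)) _.
  have := inv_sqrt_dist_ge0 y z; have := gD z.
  move: (inv_sqrt_dist y z) (`|g z|) (sqrt_pos y) (sqrt_pos z) => I u s t.
  move=> uD I0; have uI : u * I <= D * I by exact: ler_wpM2r.
  rewrite (_ : u * (6 + s * t + 2 * I) = 6 * u + s * (u * t) + 2 * (u * I)); last by ring.
  by rewrite lerD2l -mulrA ler_pM2l.
rewrite (RintegralD _ i12 i3)// (RintegralD _ i1 i2)//.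
rewrite !RintegralZl//.
have D0 : 0 <= D := le_trans (normr_ge0 _) (gD 0).
rewrite -/N -/S (_ : 16 * D = 2 * D * 8); last by ring.
rewrite addrAC; apply: lerD => //; apply: lerD => //.
by rewrite ler_wpM2l// mulr_ge0.
Qed.

Lemma energy_tail_le (M : R) : 1 < M ->
  (\int[mu]_(k in `[1%R, M]) (energy g (@xmap R) k / k)%:E <=
   ((6 * N + 16 * D) * N + S * S)%:E)%E.
Proof.
move=> M1.
have [iE igK E] := energy_kernel ig measurable_xmap (w_integrable M).
have -> : (\int[mu]_(k in `[1%R, M]) (energy g (@xmap R) k / k)%:E)%E =
   (\int[mu]_(k in setT) (w M k * energy g (@xmap R) k)%:E)%E.
  rewrite integral_mkcond; apply: eq_integral => k _.
  by rewrite /w !patchE; case: ifP => _; rewrite ?mul0r// mulrC.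
rewrite -EFin_RintegralT// lee_fin E.
apply: le_trans (ler_norm _) _.
apply: le_trans (le_normr_Rintegral _ igK) _ => //.
have ia := integrable_norm ig.
have i1 : mu.-integrable setT (EFin \o (fun y => (6 * N + 16 * D) * `|g y|)).
  by have := integrableZl measurableT (6 * N + 16 * D) ia.
have i2 : mu.-integrable setT (EFin \o (fun y => S * (`|g y| * sqrt_pos y))).
  by have := integrableZl measurableT S igs.
have i12 : mu.-integrable setT (EFin \o
    (fun y => (6 * N + 16 * D) * `|g y| + S * (`|g y| * sqrt_pos y))).
  by have := integrableD measurableT i1 i2.
apply: le_trans (le_Rintegral_setT (integrable_norm igK) i12 _) _.
  move=> y /=; rewrite normrM.
  apply: le_trans (ler_wpM2l (normr_ge0 _) (inner_le y M1)) _.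
  rewrite le_eqVlt; apply/orP; left; apply/eqP; ring.
by rewrite (RintegralD _ i1 i2)// !RintegralZl.
Qed.

Lemma energy_tail_lty :
  (\int[mu]_(k in `[1%R, +oo[) (energy g (@xmap R) k / k)%:E < +oo)%E.
Proof.
apply: le_lt_trans (ltry ((6 * N + 16 * D) * N + S * S)).
(* The right endpoints start at 2 because the truncated estimate needs M > 1; its bound is free of
   M. *)
have -> : `[1%R, +oo[%classic = \bigcup_n `[1%R, n.+2%:R : R]%classic.
  apply/seteqP; split => x /=; rewrite in_itv/= ?andbT; last first.
    by case=> n _ /=; rewrite in_itv/= => /andP[].
  move=> x1; exists (Num.truncn x) => //=; rewrite in_itv/= x1/=.
  by apply/ltW/(lt_trans (truncnS_gt _)); rewrite ltr_nat.
apply: ge0_integral_le_bigcup => //.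
- apply/nondecreasing_seqP => n; rewrite subsetEset => x /=; rewrite !in_itv/=.
  by move=> /andP[->/=] /le_trans; apply; rewrite ler_nat.
- move=> n; apply: measurable_funM.
    apply: measurable_funTS; apply: measurable_funD; apply: measurable_funX.
      exact: (measurable_phase_integral ig measurable_xmap (@continuous_cos R) (@cos_max R)).
    exact: (measurable_phase_integral ig measurable_xmap (@continuous_sin R) (@sin_max R)).
  apply: measurable_funS measurable_inv_pos => // k /=; rewrite !in_itv/= andbT.
  by move=> /andP[/(lt_le_trans ltr01)].
- move=> n x /=; rewrite in_itv/= => /andP[x1 _].
  by rewrite divr_ge0 ?addr_ge0 ?sqr_ge0// (le_trans ler01).
- by move=> n; apply: energy_tail_le; rewrite ltr1n.
Qed.

End large.
End large_frequencies.

(** * Small frequencies *)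

Section small_frequencies.
Variable R : realType.
Notation mu := (@lebesgue_measure R).

Lemma norm_diff0_le (h dh : R -> R) (t : R) :
  (forall u : R, is_derive u 1 h (dh u)) -> (forall u, `|dh u| <= 1) ->
  `|h t - h 0| <= `|t|.
Proof.
move=> D D1.
have ch (a b : R) : {within `[a, b], continuous h}.
  apply: continuous_in_subspaceT => x _; apply: differentiable_continuous.
  by apply/derivable1_diffP; have [] := D x.
have [t0|t0|->] := ltgtP t 0; last by rewrite subrr normr0.
- have [c _ E] := MVT t0 (fun x _ => D x) (ch t 0).
  by rewrite distrC E sub0r normrM normrN ler_piMl.
- have [c _ ->] := MVT t0 (fun x _ => D x) (ch 0 t).
  by rewrite subr0 normrM ler_piMl.
Qed.

(** Interpolation between the Lipschitz bound, used for |t| <= 1, and the trivial bound 2, used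
    beyond; it lets a fractional moment stand in for a first one. *)
Lemma norm_diff0_le_powR (h dh : R -> R) (d t : R) : 0 < d <= 1 ->
  (forall u : R, is_derive u 1 h (dh u)) -> (forall u, `|dh u| <= 1) ->
  (forall u, `|h u| <= 1) -> `|h t - h 0| <= 2 * `|t| `^ d.
Proof.
move=> /andP[d0 d1] D D1 h1; have [t1|t1] := leP `|t| 1.
- apply: le_trans (norm_diff0_le t D D1) _.
  have [->|t0] := eqVneq t 0; first by rewrite normr0 mulr_ge0 ?powR_ge0.
  have : `|t| <= `|t| `^ d by rewrite ger1_powR ?normr_gt0 ?t0.
  have := powR_ge0 `|t| d; lra.
- have h2 : `|h t - h 0| <= 1 + 1 by rewrite (le_trans (ler_normB _ _))// lerD.
  have : `|t| `^ 0 <= `|t| `^ d by apply: ler_powR; exact: ltW.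
  rewrite powRr0; lra.
Qed.

Section small.
Variables (g x : R -> R) (d : R).
Hypotheses (d01 : 0 < d <= 1) (ig : mu.-integrable setT (EFin \o g)).
Hypotheses (mx : measurable_fun setT x).
Hypothesis (igx : mu.-integrable setT (EFin \o (fun y => `|g y| * `|x y| `^ d))).
Let c := 2 * \int[mu]_(y in setT) (`|g y| * `|x y| `^ d).

Lemma Rintegral_phase_le (h dh : R -> R) (k : R) : continuous h ->
  (forall u : R, is_derive u 1 h (dh u)) -> (forall u, `|dh u| <= 1) ->
  (forall u, `|h u| <= 1) ->
  `|\int[mu]_(y in setT) (g y * h (k * x y)) - h 0 * \int[mu]_(y in setT) g y| <=
  `|k| `^ d * c.
Proof.
move=> ch D D1 h1.
have i1 : mu.-integrable setT (EFin \o (fun y => g y * h (k * x y))).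
  by apply: integrable_mul_bounded => //; exact: measurable_phase.
have i2 : mu.-integrable setT (EFin \o (fun y => h 0 * g y)).
  by have := integrableZl measurableT (h 0) ig.
have i12 : mu.-integrable setT (EFin \o (fun y => g y * h (k * x y) - h 0 * g y)).
  by have := integrableB measurableT i1 i2.
rewrite -RintegralZl// -(RintegralB _ i1 i2)//.
apply: le_trans (le_normr_Rintegral _ i12) _ => //.
have i3 : mu.-integrable setT (EFin \o (fun y => `|k| `^ d * 2 * (`|g y| * `|x y| `^ d))).
  by have := integrableZl measurableT (`|k| `^ d * 2) igx.
apply: le_trans (le_Rintegral_setT (integrable_norm i12) i3 _) _.
  move=> y /=; rewrite mulrC -mulrBl normrM.
  apply: le_trans (ler_wpM2r (normr_ge0 _) (norm_diff0_le_powR (k * x y) d01 D D1 h1)) _.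
  rewrite normrM powRM//; lra.
by rewrite RintegralZl// /c mulrA.
Qed.

Lemma cosint_le (k : R) : `|cosint g x k - \int[mu]_(y in setT) g y| <= `|k| `^ d * c.
Proof.
have := @Rintegral_phase_le (@cos R) (fun u => - sin u) k.
rewrite cos0 mul1r; apply.
- exact: continuous_cos.
- by move=> u; rewrite normrN sin_max.
- exact: cos_max.
Qed.

Lemma sinint_le (k : R) : `|sinint g x k| <= `|k| `^ d * c.
Proof.
have := @Rintegral_phase_le (@sin R) (@cos R) k.
rewrite sin0 mul0r subr0; apply.
- exact: continuous_sin.
- exact: cos_max.
- exact: sin_max.
Qed.

Lemma energy_small_le (k : R) : \int[mu]_(y in setT) g y = 0 -> 0 < k ->
  energy g x k <= 2 * c ^+ 2 * k `^ (2 * d).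
Proof.
move=> g0 k0; have := cosint_le k; have := sinint_le k.
rewrite g0 subr0 (gtr0_norm k0) => hs hc.
have -> : k `^ (2 * d) = (k `^ d) ^+ 2 by rewrite -powR_mulrn ?powR_ge0// -powRrM mulrC.
have sq (u : R) : `|u| <= k `^ d * c -> u ^+ 2 <= (k `^ d * c) ^+ 2.
  by move=> hu; rewrite -(real_normK (num_real u)) lerXn2r ?nnegrE// (le_trans _ hu).
have := sq _ hs; have := sq _ hc; rewrite exprMn; lra.
Qed.

End small.

Lemma norm_phase_integral_le (g x : R -> R) (h : R -> R) (k : R) :
  mu.-integrable setT (EFin \o g) -> measurable_fun setT x ->
  continuous h -> (forall u, `|h u| <= 1) ->
  `|\int[mu]_(y in setT) (g y * h (k * x y))| <= \int[mu]_(y in setT) `|g y|.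
Proof.
move=> ig mx ch h1.
have i1 : mu.-integrable setT (EFin \o (fun y => g y * h (k * x y))).
  by apply: integrable_mul_bounded => //; exact: measurable_phase.
apply: le_trans (le_normr_Rintegral _ i1) _ => //.
apply: (le_Rintegral_setT (integrable_norm i1) (integrable_norm ig)) => y /=.
by rewrite normrM ler_piMr.
Qed.

(** Beyond L > 1 one has 1 + y <= 2 y, which costs 2^(1 + a); on [0, L] the continuous function |g|
    has a maximum, and (1 + L)^(1 + a) offsets the smallest value of the weight. *)
Lemma ex_decay_bound_half (g : R -> R) (C L a : R) :
  continuous g -> 0 < C -> 1 < L -> 0 < a ->
  (forall y, L <= y -> `|g y| <= C / y `^ (1 + a)) ->
  exists2 D, 0 <= D & forall y, 0 <= y -> `|g y| <= D * (1 + `|y|) `^ (- 1 - a).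
Proof.
move=> cg C0 L1 a0 gC.
have L0 : 0 <= L by lra.
have cn : {within `[0, L], continuous (fun y => `|g y|)}.
  apply: continuous_in_subspaceT => y _.
  by apply: continuous_comp; [exact: cg|exact: norm_continuous].
have [m _ gm] := EVT_max L0 cn.
have pN (y : R) : y `^ (- 1 - a) = (y `^ (1 + a))^-1 by rewrite -powRN; congr powR; ring.
have p0 (y : R) : 0 < y -> 0 < y `^ (1 + a) by exact: powR_gt0.
have a1 : 0 <= 1 + a by lra.
exists (C * 2 `^ (1 + a) + `|g m| * (1 + L) `^ (1 + a)).
  by rewrite addr_ge0 ?mulr_ge0 ?powR_ge0 ?(ltW C0).
move=> y y0; rewrite (ger0_norm y0) pN.
have y1 : 0 < 1 + y by lra.
have [yL|Ly] := leP y L.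
- apply: (@le_trans _ _ `|g m|); first by apply: gm; rewrite in_itv/= y0.
  rewrite ler_pdivlMr ?p0// -[leLHS]add0r lerD//.
    by rewrite mulr_ge0 ?powR_ge0 ?(ltW C0).
  by rewrite ler_wpM2l// ge0_ler_powR ?nnegrE; lra.
- apply: le_trans (gC _ (ltW Ly)) _.
  have yp : 0 < y by lra.
  rewrite ler_pdivlMr ?p0// -mulrA -[leLHS]addr0 lerD//; last first.
    by rewrite mulr_ge0 ?powR_ge0.
  rewrite ler_wpM2l ?(ltW C0)// mulrC ler_pdivrMr ?p0//.
  by rewrite -powRM; [|lra|lra]; rewrite ge0_ler_powR ?nnegrE; lra.
Qed.

End small_frequencies.

(** * Weighted moments of a function with power decay *)

Section decay_weights.
Variable R : realType.
Notation mu := (@lebesgue_measure R).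

Lemma measurable_sqrt_pos : measurable_fun setT (@sqrt_pos R).
Proof.
rewrite (_ : @sqrt_pos R = (fun y => (Num.max 0 y) `^ 2^-1)); last first.
  by apply/funext => y; rewrite powR12_sqrt// le_max lexx.
apply: (measurableT_comp (measurable_powR 2^-1)).
exact: measurable_maxr.
Qed.

Lemma norm_xmap_le (y : R) : `|xmap y| <= 1 + `|y|.
Proof.
have e0 := expR_gt0 (- y).
have l0 : 0 <= ln (1 + expR (- y)) by rewrite ln_ge0// lerDl expR_ge0.
rewrite /xmap normrN (ger0_norm l0).
have [y0|y0] := leP 0 y.
- have : ln (1 + expR (- y)) <= expR (- y) by apply: le_ln1Dx; lra.
  have : expR (- y) <= 1 by rewrite -expR0 ler_expR; lra.
  have := normr_ge0 y; lra.
- rewrite -[leRHS]expRK ler_ln ?posrE ?addr_gt0 ?expR_gt0//.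
  rewrite ltr0_norm// expRD.
  have : 1 + 1 <= expR 1 :> R := expR_ge1Dx 1.
  have : 1 <= expR (- y) by rewrite -expR0 ler_expR; lra.
  nra.
Qed.

Lemma norm_xmap_le1 (y : R) : 0 <= y -> `|xmap y| <= 1.
Proof.
move=> y0; have e0 := expR_gt0 (- y).
have l0 : 0 <= ln (1 + expR (- y)) by rewrite ln_ge0// lerDl expR_ge0.
rewrite /xmap normrN (ger0_norm l0).
have : ln (1 + expR (- y)) <= expR (- y) by apply: le_ln1Dx; lra.
have : expR (- y) <= 1 by rewrite -expR0 ler_expR; lra.
lra.
Qed.

Section decay.
Variables (g : R -> R) (D e a : R).
Hypotheses (ig : mu.-integrable setT (EFin \o g)) (D0 : 0 <= D).
Hypotheses (e0 : 0 < e) (a0 : 0 < a).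
Hypothesis gneg : forall y, y <= 0 -> `|g y| <= D * (1 + `|y|) `^ (- 1 - e).
Hypothesis gpos : forall y, 0 <= y -> `|g y| <= D * (1 + `|y|) `^ (- 1 - a).

Lemma decay_bounded y : `|g y| <= D.
Proof.
have h (s : R) : 0 < s -> D * (1 + `|y|) `^ (- 1 - s) <= D.
  move=> s0; rewrite ler_piMr// -[leRHS](powRr0 (1 + `|y|)) ler_powR ?lerDl//; lra.
have [y0|y0] := leP y 0;
  [apply: le_trans (gneg y0) _|apply: le_trans (gpos (ltW y0)) _];
  exact: h.
Qed.

(** The number b is the decay in excess of 1/|y| that survives the weight: on either side the
    exponents -1 - s and s - b add up to -1 - b, with s = e on the left and s = a on the right. *)
Lemma integrable_weight (q : R -> R) (b : R) : 0 < b -> measurable_fun setT q ->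
  (forall y, 0 <= q y) ->
  (forall y, y <= 0 -> q y <= (1 + `|y|) `^ (e - b)) ->
  (forall y, 0 <= y -> q y <= (1 + `|y|) `^ (a - b)) ->
  mu.-integrable setT (EFin \o (fun y => `|g y| * q y)).
Proof.
move=> b0 mq q0 qneg qpos.
have I := integrableZl measurableT D (integrable_decay b0).
apply: le_integrable I => //.
  apply/measurable_EFinP; apply: measurable_funM => //.
  by apply: measurableT_comp => //; exact: (integrable_measurable ig).
move=> y _; rewrite /= lee_fin normrM normr_id (ger0_norm (q0 y)).
rewrite (ger0_norm (mulr_ge0 D0 (powR_ge0 _ _))).
have h (s : R) : `|g y| <= D * (1 + `|y|) `^ (- 1 - s) -> q y <= (1 + `|y|) `^ (s - b) ->
    `|g y| * q y <= D * (1 + `|y|) `^ (- 1 - b).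
  move=> h1 h2; have -> : - 1 - b = (- 1 - s) + (s - b) by ring.
  rewrite powRD; last by apply/implyP => _; rewrite gt_eqF// ltr_pwDl.
  by rewrite mulrA ler_pM.
have [y0|y0] := leP y 0; first exact: (h _ (gneg y0) (qneg _ y0)).
exact: (h _ (gpos (ltW y0)) (qpos _ (ltW y0))).
Qed.

Let ler1D (y : R) : 1 <= 1 + `|y|. Proof. by rewrite lerDl. Qed.

Lemma integrable_sqrt_pos : 2^-1 < a ->
  mu.-integrable setT (EFin \o (fun y => `|g y| * sqrt_pos y)).
Proof.
(* Positivity of this b is the condition a > 1/2; on the left half-line the weight vanishes. *)
move=> a2; apply: (@integrable_weight _ (a - 2^-1)).
- by rewrite subr_gt0.
- exact: measurable_sqrt_pos.
- by move=> y; exact: sqrtr_ge0.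
- by move=> y y0; rewrite /sqrt_pos max_l// sqrtr0 powR_ge0.
- move=> y y0; rewrite /sqrt_pos max_r// (_ : a - (a - 2^-1) = 2^-1); last by ring.
  by rewrite powR12_sqrt ?addr_ge0// ler_wsqrtr// (ger0_norm y0) lerDr.
Qed.

(** On y >= 0 the phase is bounded, so the right side keeps its whole excess a; on y <= 0 it grows
    at most linearly and leaves e - d. The common excess is the smaller one. *)
Lemma integrable_xmap_powR d : 0 < d < e ->
  mu.-integrable setT (EFin \o (fun y => `|g y| * `|xmap y| `^ d)).
Proof.
move=> /andP[d0 de]; apply: (@integrable_weight _ (Num.min (e - d) a)).
- by rewrite lt_min subr_gt0 de.
- apply: (measurableT_comp (measurable_powR d)).
  by apply: measurableT_comp => //; exact: measurable_xmap.
- by move=> y; exact: powR_ge0.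
- move=> y y0; apply: (@le_trans _ _ ((1 + `|y|) `^ d)).
    by rewrite ge0_ler_powR ?nnegrE ?(ltW d0)// ?addr_ge0//; exact: norm_xmap_le.
  rewrite ler_powR//.
  have : Num.min (e - d) a <= e - d by rewrite ge_min lexx.
  lra.
- move=> y y0; apply: (@le_trans _ _ ((1 + `|y|) `^ 0)).
    rewrite powRr0; apply: (@le_trans _ _ (1 `^ d)); last by rewrite powR1.
    by rewrite ge0_ler_powR ?nnegrE ?(ltW d0)//; exact: norm_xmap_le1.
  by rewrite ler_powR// subr_ge0 ge_min lexx orbT.
Qed.

Lemma integrable_norm_powR d : 0 < d -> d < e -> d < a ->
  mu.-integrable setT (EFin \o (fun y => `|g y| * `|y| `^ d)).
Proof.
move=> d0 de da; apply: (@integrable_weight _ (Num.min (e - d) (a - d))).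
- by rewrite lt_min !subr_gt0 de.
- by apply: (measurableT_comp (measurable_powR d)).
- by move=> y; exact: powR_ge0.
- move=> y y0; apply: (@le_trans _ _ ((1 + `|y|) `^ d)).
    by rewrite ge0_ler_powR ?nnegrE ?(ltW d0)// ?addr_ge0// lerDr.
  rewrite ler_powR//.
  have : Num.min (e - d) (a - d) <= e - d by rewrite ge_min lexx.
  lra.
- move=> y y0; apply: (@le_trans _ _ ((1 + `|y|) `^ d)).
    by rewrite ge0_ler_powR ?nnegrE ?(ltW d0)// ?addr_ge0// lerDr.
  rewrite ler_powR//.
  have : Num.min (e - d) (a - d) <= a - d by rewrite ge_min lexx orbT.
  lra.
Qed.

End decay.

Lemma integrable_small_large (h : R -> R) (A a : R) : 0 < a -> 0 <= A ->
  measurable_fun (`]0%R, +oo[%classic : set R) h ->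
  (forall k, 0 < k -> 0 <= h k) ->
  (forall k, 0 < k < 1 -> h k <= A * k `^ (a - 1)) ->
  (\int[mu]_(k in `[1%R, +oo[) (h k)%:E < +oo)%E ->
  mu.-integrable `]0%R, +oo[ (EFin \o h).
Proof.
move=> a0 A0 mh h0 hA hoo.
apply/integrableP; split; first exact/measurable_EFinP.
have -> : (\int[mu]_(k in `]0%R, +oo[) `|(EFin \o h) k| =
    \int[mu]_(k in `]0%R, +oo[) (h k)%:E)%E.
  by apply: eq_integral => k; rewrite inE/= in_itv/= andbT => k0; rewrite ger0_norm// h0.
have E : `]0%R, +oo[%classic = `]0%R, 1%R[%classic `|` `[1%R, +oo[%classic :> set R.
  apply/seteqP; split => k /=; rewrite !in_itv/= ?andbT.
    by move=> k0; rewrite k0/=; have [k1|k1] := ltP k 1; [left|right].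
  by case=> [/andP[]//|]; exact: lt_le_trans.
have mh1 : measurable_fun (`]0%R, 1%R[%classic : set R) h.
  by apply: measurable_funS mh => //; rewrite E; exact: subsetUl.
rewrite E ge0_integral_setU//; last 3 first.
- by rewrite -E; exact/measurable_EFinP.
- by rewrite -E => k /=; rewrite in_itv/= andbT lee_fin => /h0.
- apply/disj_setPS => k [] /=; rewrite !in_itv/= andbT => /andP[_ k1] /(lt_le_trans k1).
  by rewrite ltxx.
apply: lte_add_pinfty => //.
have mp : measurable_fun (`]0%R, 1%R[%classic : set R) (fun k : R => (k - 0) `^ (a - 1)).
  apply: open_continuous_measurable_fun => // k; rewrite inE/= in_itv/= => /andP[k0 _].
  apply: (@continuous_powR_comp R (fun k : R => k - 0)); first by rewrite subr0.
  by apply: continuousB; [exact: cvg_id|exact: cvg_cst].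
apply: (@le_lt_trans _ _ (\int[mu]_(k in `]0%R, 1%R[) (A%:E * ((k - 0) `^ (a - 1))%:E))%E).
  apply: ge0_le_integral => //.
  - by move=> k /=; rewrite in_itv/= lee_fin => /andP[/h0].
  - exact/measurable_EFinP.
  - by apply/measurable_EFinP; exact: measurable_funM.
  - by move=> k /=; rewrite in_itv/= -EFinM lee_fin subr0; exact: hA.
rewrite ge0_integralZl//; last 2 first.
- exact/measurable_EFinP.
- by move=> k _; rewrite lee_fin powR_ge0.
have := integral_powR_right 0 a0; rewrite add0r => B.
apply: (@le_lt_trans _ _ (A%:E * (a^-1 + a^-1)%:E)%E); last by rewrite -EFinM ltry.
by rewrite lee_wpmul2l// lee_fin.
Qed.

End decay_weights.

(** * Both weighted energies of a real function *)

Section integrable_energies.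
Variable R : realType.
Notation mu := (@lebesgue_measure R).

Lemma measurable_energy (g x : R -> R) :
  mu.-integrable setT (EFin \o g) -> measurable_fun setT x ->
  measurable_fun setT (fun k : R => energy g x k).
Proof.
move=> ig mx; apply: measurable_funD; apply: measurable_funX.
  exact: (measurable_phase_integral ig mx
      (@continuous_cos R) (@cos_max R)).
exact: (measurable_phase_integral ig mx
      (@continuous_sin R) (@sin_max R)).
Qed.

Lemma energy_ge0 (g x : R -> R) (k : R) : 0 <= energy g x k.
Proof. by rewrite addr_ge0 ?sqr_ge0. Qed.

(** This linear bound serves at both ends: it has the right order at k = 0, and with the other
    factor 1/k it gives the integrable decay 1/k^2 at infinity. *)
Lemma expR_2pi_ge (k : R) : 0 < k -> k <= expR (2 * pi * k) - 1.
Proof.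
move=> k0; have := expR_ge1Dx (2 * pi * k).
have p2 : 2 <= pi :> R := pi_ge2 R.
have : 1 * k <= 2 * pi * k by rewrite ler_pM2r//; lra.
rewrite mul1r; move: (2 * pi * k) => t; move: (expR t) => E; lra.
Qed.

Lemma measurable_thermal_weight :
  measurable_fun (`]0%R, +oo[%classic : set R) (fun k : R => (expR (2 * pi * k) - 1)^-1).
Proof.
apply: open_continuous_measurable_fun => // k; rewrite inE/= in_itv/= andbT => k0.
apply: (@continuousV _ _ (fun k : R => expR (2 * pi * k) - 1)).
  by rewrite gt_eqF// (lt_le_trans k0 (expR_2pi_ge k0)).
apply: continuousB; last exact: cvg_cst.
apply: (@continuous_comp _ _ _ (fun k : R => 2 * pi * k) (@expR R)).
  by apply: continuousM; [exact: cvg_cst|exact: cvg_id].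
exact: continuous_expR.
Qed.

Section real_part.
Variables (g : R -> R) (D e a : R).
Hypotheses (ig : mu.-integrable setT (EFin \o g)) (D0 : 0 <= D).
Hypotheses (e0 : 0 < e) (a0 : 2^-1 < a).
Hypothesis gneg : forall y, y <= 0 -> `|g y| <= D * (1 + `|y|) `^ (- 1 - e).
Hypothesis gpos : forall y, 0 <= y -> `|g y| <= D * (1 + `|y|) `^ (- 1 - a).
Hypothesis g0 : \int[mu]_(y in setT) g y = 0.

Let a_gt0 : 0 < a. Proof. by apply: lt_trans a0; rewrite invr_gt0. Qed.

Lemma integrable_energy_xmap : mu.-integrable `]0%R, +oo[
  (EFin \o (fun k => energy g (@xmap R) k / k)).
Proof.
(* Halving the minimum ensures d < e strictly, for the moment, and d <= 1, for the interpolation. *)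
pose d := Num.min e 1 / 2.
have m0 : 0 < Num.min e 1 by rewrite lt_min e0 ltr01.
have m1 : Num.min e 1 <= 1 by rewrite ge_min lexx orbT.
have me : Num.min e 1 <= e by rewrite ge_min lexx.
have de : 0 < d < e by rewrite /d; apply/andP; split; lra.
have d1 : 0 < d <= 1 by rewrite /d; apply/andP; split; lra.
have igx := integrable_xmap_powR ig D0 a_gt0 gneg gpos de.
have d20 : 0 < 2 * d by case/andP: d1 => ? _; rewrite mulr_gt0.
have S k := energy_small_le (k := k) d1 ig (@measurable_xmap R) igx g0.
set c := 2 * _ ^+ 2 in S.
apply: (@integrable_small_large _ _ c (2 * d) d20).
- by rewrite mulr_ge0 ?sqr_ge0.
- apply: measurable_funM; last exact: measurable_inv_pos.
  by apply: measurable_funTS; exact: measurable_energy ig (@measurable_xmap R).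
- by move=> k k0; rewrite divr_ge0 ?energy_ge0 ?ltW.
- move=> k /andP[k0 _].
  have -> : k `^ (2 * d - 1) = k `^ (2 * d) / k.
    by rewrite powRB ?powRr1 ?(ltW k0)//; apply/implyP => _; rewrite gt_eqF.
  by rewrite mulrA ler_wpM2r ?invr_ge0 ?(ltW k0)//; exact: S.
- apply: energy_tail_lty (decay_bounded D0 e0 a_gt0 gneg gpos) _ => //.
  exact: integrable_sqrt_pos ig D0 gneg gpos a0.
Qed.

Lemma integrable_energy_thermal : 2^-1 < e -> mu.-integrable `]0%R, +oo[
  (EFin \o (fun k => energy g id k / k / (expR (2 * pi * k) - 1))).
Proof.
move=> e2.
(* The midpoint of 1/2 and m is below 1, e and a, and gives 2 d - 1 > 0, which makes k^(2 d) / k^2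
   integrable at 0. *)
pose m := Num.min 1 (Num.min e a); pose d := (2^-1 + m) / 2.
have m0 : 2^-1 < m by rewrite !lt_min e2 a0 andbT; lra.
have m1 : m <= 1 by rewrite ge_min lexx.
have me : m <= e by rewrite !ge_min lexx orbT.
have ma : m <= a by rewrite !ge_min lexx !orbT.
have d2 : 2^-1 < d by rewrite /d; lra.
have d1 : 0 < d <= 1 by rewrite /d; apply/andP; split; lra.
have d0 : 0 < d by rewrite /d; lra.
have de : d < e by rewrite /d; lra.
have da : d < a by rewrite /d; lra.
have igx := integrable_norm_powR ig D0 gneg gpos d0 de da.
have d20 : 0 < 2 * d - 1 by lra.
have mid : measurable_fun setT (@id R) by exact: measurable_id.
have S k := energy_small_le (k := k) d1 ig mid igx g0.
set h := (fun k => _ / _ / _).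
have W k : 0 < k -> h k <= energy g id k / (k * k).
  move=> k0; have kE := expR_2pi_ge k0.
  rewrite /h invfM mulrA ler_wpM2l//.
    by rewrite divr_ge0 ?energy_ge0 ?(ltW k0).
  by rewrite lef_pV2 ?posrE// (lt_le_trans k0 kE).
have h0 k : 0 < k -> 0 <= h k.
  move=> k0; rewrite /h !divr_ge0 ?energy_ge0 ?(ltW k0)//.
  exact: le_trans (ltW k0) (expR_2pi_ge k0).
have mh : measurable_fun (`]0%R, +oo[%classic : set R) h.
  apply: measurable_funM.
    apply: measurable_funM; last exact: measurable_inv_pos.
    by apply: measurable_funTS; exact: measurable_energy ig mid.
  exact: measurable_thermal_weight.
set c := 2 * _ ^+ 2 in S.
apply: (@integrable_small_large _ _ c (2 * d - 1) d20 _ mh h0).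
- by rewrite mulr_ge0 ?sqr_ge0.
- move=> k /andP[k0 _]; apply: le_trans (W _ k0) _.
  have -> : k `^ (2 * d - 1 - 1) = k `^ (2 * d) / (k * k).
    have kn (s : R) : (s == 1) ==> (k != 0) by apply/implyP => _; rewrite gt_eqF.
    by rewrite !powRB ?kn // !powRr1 ?(ltW k0)// invfM [RHS]mulrA.
  by rewrite mulrA ler_wpM2r ?invr_ge0 ?mulr_ge0 ?(ltW k0)//; exact: S.
(* For k >= 1 the trivial bound 2 N^2 on the energy suffices; 1 / k^2 <= 4 / (1 + k)^2 there, hence
   8 = 2 * 4. *)
- pose N := \int[mu]_(y in setT) `|g y|.
  have N0 : 0 <= N by apply: Rintegral_ge0.
  have sq (u : R) : `|u| <= N -> u ^+ 2 <= N ^+ 2.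
    by move=> hu; rewrite -(real_normK (num_real u)) lerXn2r ?nnegrE.
  have EN k : energy g id k <= 2 * N ^+ 2.
    rewrite mulr_natl mulr2n lerD// sq//.
      exact: norm_phase_integral_le ig mid (@continuous_cos R) (@cos_max R).
    exact: norm_phase_integral_le ig mid (@continuous_sin R) (@sin_max R).
  have I : mu.-integrable setT (EFin \o
      (fun k : R => 8 * N ^+ 2 * (1 + `|k|) `^ (-1 - 1))).
    by have := integrableZl measurableT (8 * N ^+ 2)
      (integrable_decay (ltr01 : 0 < 1 :> R)).
  have I1 : mu.-integrable `[1%R, +oo[ (EFin \o
      (fun k : R => 8 * N ^+ 2 * (1 + `|k|) `^ (-1 - 1))).
    exact: integrableS I.
  have sub : `[1%R, +oo[ `<=` (`]0%R, +oo[%classic : set R).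
    by move=> k /=; rewrite !in_itv/= !andbT; exact: lt_le_trans.
  have mh1 : measurable_fun (`[1%R, +oo[%classic : set R) h by apply: measurable_funS mh.
  have I2 : mu.-integrable `[1%R, +oo[ (EFin \o h).
    apply: le_integrable I1 => //; first exact/measurable_EFinP.
    move=> k; rewrite /= in_itv/= andbT => k1.
    have k0 : 0 < k by exact: lt_le_trans k1.
    rewrite lee_fin (ger0_norm (h0 _ k0)) ger0_norm; last first.
      by rewrite !mulr_ge0 ?sqr_ge0 ?powR_ge0.
    apply: le_trans (W _ k0) _.
    have -> : (1 + `|k|) `^ (-1 - 1) = ((1 + k) ^+ 2)^-1.
      rewrite (ger0_norm (ltW k0)) -powR_invn; last by lra.
      by congr powR; ring.
    apply: (@le_trans _ _ (2 * N ^+ 2 / (k * k))).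
      by rewrite ler_wpM2r ?EN// invr_ge0 mulr_ge0 ?(ltW k0).
    have -> : 8 * N ^+ 2 / (1 + k) ^+ 2 = 2 * N ^+ 2 * (4 / (1 + k) ^+ 2) by ring.
    apply: ler_wpM2l; first by rewrite mulr_ge0 ?sqr_ge0.
    rewrite ler_pdivlMr ?exprn_gt0//; last lra.
    rewrite mulrC ler_pdivrMr ?mulr_gt0//; nra.
  exact: (integrable_lty _ I2).
Qed.

End real_part.

End integrable_energies.

(** * Complex-valued functions *)

Section complex_valued.
Variable R : realType.
Notation mu := (@lebesgue_measure R).

Lemma eq0_of_powR_bound (u c d : R) : 0 < d ->
  (forall t, 0 < t -> `|u| <= t `^ d * c) -> u = 0.
Proof.
move=> d0 H; apply/eqP; rewrite -normr_le0; apply/ler_addgt0Pl => s s0; rewrite addr0.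
(* The maximum makes the divisor positive whatever the sign of c; the chosen t solves t^d * max(c,
   1) = s. *)
have c0 : 0 < Num.max c 1 by rewrite lt_max ltr01 orbT.
have t0 : 0 < (s / Num.max c 1) `^ d^-1 by rewrite powR_gt0// divr_gt0.
apply: le_trans (H _ t0) _.
rewrite -powRrM mulVf ?gt_eqF// powRr1 ?(divr_ge0 (ltW s0) (ltW c0))//.
by rewrite -mulrA ler_piMr ?(ltW s0)// mulrC ler_pdivrMr// mul1r le_max lexx.
Qed.

Lemma ex_decay_bound (g : R -> R) (C L a e : R) : continuous g ->
  0 < C -> 1 < L -> 0 < a -> 0 < e ->
  (forall y, y <= - L -> `|g y| <= C / ((- y) `^ (1 + e))) ->
  (forall y, L <= y -> `|g y| <= C / (y `^ (1 + a))) ->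
  exists D, [/\ 0 <= D,
    forall y, y <= 0 -> `|g y| <= D * (1 + `|y|) `^ (- 1 - e) &
    forall y, 0 <= y -> `|g y| <= D * (1 + `|y|) `^ (- 1 - a)].
Proof.
move=> cg C0 L1 a0 e0 gneg gpos.
have [D1 D10 H1] := ex_decay_bound_half cg C0 L1 a0 gpos.
have cg' : continuous (fun y => g (- y)).
  move=> y; apply: (@continuous_comp _ _ _ (fun y : R => - y) g); last exact: cg.
  by apply: continuousN; exact: cvg_id.
have gneg' (y : R) : L <= y -> `|g (- y)| <= C / y `^ (1 + e).
  by move=> Ly; have := gneg (- y); rewrite opprK; apply; rewrite lerN2.
have [D2 D20 H2] := ex_decay_bound_half cg' C0 L1 e0 gneg'.
exists (Num.max D1 D2); split; first by rewrite le_max D10.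
- move=> y y0; have := H2 (- y); rewrite opprK normrN oppr_ge0 => /(_ y0) /le_trans; apply.
  by rewrite ler_wpM2r ?powR_ge0// le_max lexx orbT.
- move=> y y0; apply: le_trans (H1 _ y0) _.
  by rewrite ler_wpM2r ?powR_ge0// le_max lexx.
Qed.

Section complex.
Variables (fr fi : R -> R).
Hypotheses (ir : mu.-integrable setT (EFin \o fr))
  (ii : mu.-integrable setT (EFin \o fi)).

Let mid : measurable_fun setT (@id R). Proof. exact: measurable_id. Qed.

Lemma FT_reE p : FT_re fr fi p = fnorm R * (cosint fr id p + sinint fi id p).
Proof.
by rewrite /FT_re -RintegralD//; [exact: integrable_cosint|exact: integrable_sinint].
Qed.

Lemma FT_imE p : FT_im fr fi p = fnorm R * (cosint fi id p - sinint fr id p).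
Proof.
by rewrite /FT_im -RintegralB//; [exact: integrable_cosint|exact: integrable_sinint].
Qed.

Lemma FTc_reE k :
  FTc_re fr fi k = fnorm R * (cosint fr (@xmap R) k - sinint fi (@xmap R) k).
Proof.
by rewrite /FTc_re -RintegralB//; [apply: integrable_cosint|apply: integrable_sinint] => //;
  exact: measurable_xmap.
Qed.

Lemma FTc_imE k :
  FTc_im fr fi k = fnorm R * (sinint fr (@xmap R) k + cosint fi (@xmap R) k).
Proof.
by rewrite /FTc_im -RintegralD//; [apply: integrable_sinint|apply: integrable_cosint] => //;
  exact: measurable_xmap.
Qed.

(** At p = -t a vanishing real part reads [cosint fr] = - [sinint fi]. The left side is within
    O(t^d) of \int fr and the right side is O(t^d), so \int fr is below every c t^d. The imaginary
    part gives \int fi likewise. *)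
Lemma Rintegral_eq0_of_FT d : 0 < d <= 1 ->
  mu.-integrable setT (EFin \o (fun y => `|fr y| * `|y| `^ d)) ->
  mu.-integrable setT (EFin \o (fun y => `|fi y| * `|y| `^ d)) ->
  (forall p : R, p < 0 -> FT_re fr fi p = 0 /\ FT_im fr fi p = 0) ->
  \int[mu]_(y in setT) fr y = 0 /\ \int[mu]_(y in setT) fi y = 0.
Proof.
move=> d01 igr igi F0.
have [d0 _] := andP d01.
have fn0 : fnorm R != 0.
  by rewrite invr_neq0// gt_eqF// sqrtr_gt0 mulr_gt0// pi_gt0.
have aux (S I A B : R) : `|S| <= B -> `|- S - I| <= A -> `|I| <= A + B.
  by rewrite !ler_norml; lra.
split; apply: (@eq0_of_powR_bound _ (2 * \int[mu]_(y in setT) (`|fr y| * `|y| `^ d) +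
   2 * \int[mu]_(y in setT) (`|fi y| * `|y| `^ d)) _ d0) => t t0.
- have := F0 (- t); rewrite oppr_lt0 => /(_ t0) [+ _].
  rewrite FT_reE => /eqP; rewrite mulf_eq0 (negbTE fn0)/= addr_eq0 => /eqP E.
  have := cosint_le d01 ir mid igr (- t); have := sinint_le d01 ii mid igi (- t).
  rewrite E (normrN t) (gtr0_norm t0) mulrDr => h1 h2.
  exact: (aux _ _ _ _ h1 h2).
- have := F0 (- t); rewrite oppr_lt0 => /(_ t0) [_ +].
  rewrite FT_imE => /eqP; rewrite mulf_eq0 (negbTE fn0)/= subr_eq0 => /eqP E.
  have := cosint_le d01 ii mid igi (- t); have := sinint_le d01 ir mid igr (- t).
  rewrite E (normrN t) (gtr0_norm t0) mulrDr => h1 h2.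
  by rewrite addrC; apply: (aux (- sinint fr id (- t))); rewrite ?opprK ?normrN.
Qed.

End complex.

Lemma lty_of_le_integrableD (h h1 h2 : R -> R) (c : R)
    (D : set (measurableTypeR R)) : measurable D ->
  measurable_fun D h -> (forall k, D k -> 0 <= h k) ->
  mu.-integrable D (EFin \o h1) -> mu.-integrable D (EFin \o h2) ->
  (forall k, D k -> h k <= c * (h1 k + h2 k)) ->
  (\int[mu]_(k in D) (h k)%:E < +oo)%E.
Proof.
move=> mD mh h0 i1 i2 hle.
have i12 := integrableZl mD c (integrableD mD i1 i2).
apply: (integrable_lty mD (f := EFin \o h)).
apply: le_integrable i12 => //; first exact/measurable_EFinP.
move=> k Dk; rewrite /= lee_fin ger0_norm ?h0//.
exact: le_trans (hle _ Dk) (ler_norm _).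
Qed.

(** The right side exceeds the left by u^2 ((a + b)^2 + (c - d)^2). The grouping pairs the cosine
    and sine integrals of the same part of f. *)
Lemma sqr_sum_le (u a b c d : R) :
  (u * (a - b)) ^+ 2 + (u * (c + d)) ^+ 2 <=
  2 * u ^+ 2 * ((a ^+ 2 + c ^+ 2) + (d ^+ 2 + b ^+ 2)).
Proof.
have := mulr_ge0 (sqr_ge0 u) (addr_ge0 (sqr_ge0 (a + b)) (sqr_ge0 (c - d))).
rewrite !expr2; lra.
Qed.

(** W is 1 for [Nbar] and e^(2 pi k) - 1 for [NTh]. The 2 of the parallelogram bound cancels that of
    2 k. *)
Lemma energy_div_le (N E F u k W : R) : 0 < k -> 0 <= W ->
  N <= 2 * u * (E + F) -> N / (2 * k) / W <= u * (E / k / W + F / k / W).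
Proof.
move=> k0 W0 h; have k'0 : 0 <= k^-1 by rewrite invr_ge0 ltW.
have W'0 : 0 <= W^-1 by rewrite invr_ge0.
rewrite invfM; move: (k^-1) (W^-1) k'0 W'0 => k' W' k'0 W'0.
have -> : u * (E * k' * W' + F * k' * W') = 2 * u * (E + F) * (2^-1 * k') * W' by field.
by rewrite !ler_wpM2r// mulr_ge0.
Qed.

Lemma norm_le_cabs (f g : R -> R) y : `|f y| <= cabs f g y /\ `|g y| <= cabs f g y.
Proof.
by split; rewrite /cabs -sqrtr_sqr ler_wsqrtr// ?lerDl ?lerDr sqr_ge0.
Qed.

End complex_valued.

Theorem theorem2 (R : realType) (fr fi : R -> R) (C L alpha eps : R) :
  (* Fourier transform vanishes for negative arguments *)
  (forall p : R, p < 0 -> FT_re fr fi p = 0 /\ FT_im fr fi p = 0) ->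
  (* normalisation *)
  fnorm2 fr fi = 1%:E ->
  (* f differentiable, f and f' integrable *)
  (forall y : R, derivable fr y 1 /\ derivable fi y 1) ->
  cintegrable fr fi ->
  cintegrable (derive1 fr) (derive1 fi) ->
  0 < C -> 1 < L -> 1 / 2 < alpha -> 0 < eps ->
  (forall y : R, y <= - L -> cabs fr fi y <= C / ((- y) `^ (1 + eps))) ->
  (forall y : R, L <= y -> cabs fr fi y <= C / (y `^ (1 + alpha))) ->
  (Nbar fr fi < +oo)%E /\ (1 / 2 < eps -> (NTh (2 * pi) fr fi < +oo)%E).
Proof.
move=> F0 _ df [ir ii] _ C0 L1 + e0 Hneg Hpos; rewrite div1r => a2.
have a0 : 0 < alpha by apply: lt_trans a2; rewrite invr_gt0.
have cr : continuous fr.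
  by move=> y; apply: differentiable_continuous; apply/derivable1_diffP; have [] := df y.
have ci : continuous fi.
  by move=> y; apply: differentiable_continuous; apply/derivable1_diffP; have [] := df y.
have le1 y := (norm_le_cabs fr fi y).1.
have le2 y := (norm_le_cabs fr fi y).2.
have [Dr [Dr0 rneg rpos]] := ex_decay_bound cr C0 L1 a0 e0
  (fun y hy => le_trans (le1 y) (Hneg y hy)) (fun y hy => le_trans (le1 y) (Hpos y hy)).
have [Di [Di0 ineg ipos]] := ex_decay_bound ci C0 L1 a0 e0
  (fun y hy => le_trans (le2 y) (Hneg y hy)) (fun y hy => le_trans (le2 y) (Hpos y hy)).
(* This d only serves to obtain \int f = 0, for which any small positive exponent will do; the two
   integrability lemmas choose their own. *)
pose m := Num.min 1 (Num.min eps alpha); pose d := m / 2.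
have m0 : 0 < m by rewrite !lt_min ltr01 e0.
have m1 : m <= 1 by rewrite ge_min lexx.
have me : m <= eps by rewrite !ge_min lexx orbT.
have ma : m <= alpha by rewrite !ge_min lexx !orbT.
have d0 : 0 < d by rewrite /d; lra.
have d01 : 0 < d <= 1 by rewrite /d; apply/andP; split; lra.
have de : d < eps by rewrite /d; lra.
have da : d < alpha by rewrite /d; lra.
have [r0 i0] := Rintegral_eq0_of_FT ir ii d01
  (integrable_norm_powR ir Dr0 rneg rpos d0 de da)
  (integrable_norm_powR ii Di0 ineg ipos d0 de da) F0.
have mD : measurable (`]0%R, +oo[%classic : set R) by exact: measurable_itv.
have mid : measurable_fun setT (@id R) by exact: measurable_id.
have mc (g x : R -> R) : (@lebesgue_measure R).-integrable setT (EFin \o g) ->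
    measurable_fun setT x -> measurable_fun setT (cosint g x).
  by move=> ig mx; exact: (measurable_phase_integral ig mx
      (@continuous_cos R) (@cos_max R)).
have ms (g x : R -> R) : (@lebesgue_measure R).-integrable setT (EFin \o g) ->
    measurable_fun setT x -> measurable_fun setT (sinint g x).
  by move=> ig mx; exact: (measurable_phase_integral ig mx
      (@continuous_sin R) (@sin_max R)).
have m2 : measurable_fun (`]0%R, +oo[%classic : set R) (fun k : R => (2 * k)^-1).
  rewrite (_ : (fun k : R => (2 * k)^-1) = (fun k => 2^-1 * k^-1)); last first.
    by apply/funext => k; rewrite invfM.
  by apply: measurable_funM => //; exact: measurable_inv_pos.
split.
- apply: (lty_of_le_integrableD (c := fnorm R ^+ 2) mD _ _
    (integrable_energy_xmap ir Dr0 e0 a2 rneg rpos r0)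
    (integrable_energy_xmap ii Di0 e0 a2 ineg ipos i0)).
  + apply: measurable_funM => //; apply: measurable_funTS.
    apply: measurable_funD; apply: measurable_funX.
      rewrite (_ : FTc_re fr fi = (fun k =>
        fnorm R * (cosint fr (@xmap R) k - sinint fi (@xmap R) k)));
        last by apply/funext => k; exact: FTc_reE.
      apply: measurable_funM => //; apply: measurable_funB; [apply: mc|apply: ms] => //;
        exact: measurable_xmap.
    rewrite (_ : FTc_im fr fi = (fun k =>
        fnorm R * (sinint fr (@xmap R) k + cosint fi (@xmap R) k)));
        last by apply/funext => k; exact: FTc_imE.
    apply: measurable_funM => //; apply: measurable_funD; [apply: ms|apply: mc] => //;
      exact: measurable_xmap.
  + move=> k /=; rewrite in_itv/= andbT => k0.
    by rewrite divr_ge0 ?addr_ge0 ?sqr_ge0 ?mulr_ge0 ?(ltW k0).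
  + move=> k /=; rewrite in_itv/= andbT => k0.
    have := sqr_sum_le (fnorm R) (cosint fr (@xmap R) k) (sinint fi (@xmap R) k)
      (sinint fr (@xmap R) k) (cosint fi (@xmap R) k).
    by rewrite FTc_reE// FTc_imE// => /(energy_div_le k0 ler01); rewrite !divr1.
- move=> e2.
  apply: (lty_of_le_integrableD (c := fnorm R ^+ 2) mD _ _
    (integrable_energy_thermal ir Dr0 a2 rneg rpos r0 e2)
    (integrable_energy_thermal ii Di0 a2 ineg ipos i0 e2)).
  + apply: measurable_funM; last exact: measurable_thermal_weight.
    apply: measurable_funM => //; apply: measurable_funTS.
    apply: measurable_funD; apply: measurable_funX.
      rewrite (_ : FT_re fr fi = (fun k => fnorm R * (cosint fr id k + sinint fi id k)));
        last by apply/funext => k; exact: FT_reE.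
      by apply: measurable_funM => //; apply: measurable_funD; [apply: mc|apply: ms].
    rewrite (_ : FT_im fr fi = (fun k => fnorm R * (cosint fi id k - sinint fr id k)));
      last by apply/funext => k; exact: FT_imE.
    by apply: measurable_funM => //; apply: measurable_funB; [apply: mc|apply: ms].
  + move=> k /=; rewrite in_itv/= andbT => k0.
    apply: divr_ge0; last exact: le_trans (ltW k0) (expR_2pi_ge k0).
    by rewrite divr_ge0 ?addr_ge0 ?sqr_ge0 ?mulr_ge0 ?(ltW k0).
  + move=> k /=; rewrite in_itv/= andbT => k0.
    have W0 := le_trans (ltW k0) (expR_2pi_ge k0).
    (* In e^(-ipy) the sign is opposite to that in e^(ikx), so here the imaginary part carries the
       difference and the squares must be regrouped into the energies of [fr] and [fi]. *)
    have := sqr_sum_le (fnorm R) (cosint fi id k) (sinint fr id k)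
      (cosint fr id k) (sinint fi id k).
    rewrite FT_reE// FT_imE// addrC => h; apply: energy_div_le => //.
    by apply: le_trans h _; rewrite le_eqVlt; apply/orP; left; apply/eqP; ring.
Qed.
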